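(* Let $\mathbf{X}=(X(t),t\in\mathbb{R})$ be a stationary process with upper semi-continuous sample paths, satisfying Assumption L, and let $T>0$. Then the version $f_{\mathbf{X},T}$ (given by the right derivative of the cumulative distribution function) of the density of the leftmost location of the supremum in the interval $[0,T]$ has the following properties. (a) $f_{\mathbf{X},T}(0+)<\infty$, $f_{\mathbf{X},T}(T-)<\infty$ and $\mathrm{TV}_{(0,T)}(f_{\mathbf{X},T})\le f_{\mathbf{X},T}(0+)+f_{\mathbf{X},T}(T-)$. In particular, the density has a bounded variation on the entire interval $(0,T)$. (b) Assume additionally that the process is sample continuous and satisfies Assumption $\mathrm{U}_T$. Then either $f_{\mathbf{X},T}(t)=1/T$ for all $0<t<T$, or $\int_0^T f_{\mathbf{X},T}(t)\,dt<1$.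
   Context: The process $\mathbf{X}$ is real-valued and defined on a probability space $(\Omega,\mathcal{F},P)$. Since its sample paths are upper semi-continuous, the process is bounded from above on any compact interval and its supremum over that interval is attained. $\tau_{\mathbf{X},T}=\min\{t\in[0,T]: X(t)=\sup_{0\le s\le T}X(s)\}$ is the leftmost location of the supremum in $[0,T]$; it is a random variable, and $F_{\mathbf{X},T}$ denotes its law, a probability measure on $[0,T]$ (which may have atoms at $0$ and $T$). For a stationary process with upper semi-continuous sample paths, the restriction of $F_{\mathbf{X},T}$ to $(0,T)$ is absolutely continuous, the cumulative distribution function of $F_{\mathbf{X},T}$ has a right derivative at every point of $(0,T)$, and $f_{\mathbf{X},T}$ denotes the version of the density equal to this right derivative; it is right continuous with left limits, and the limits $f_{\mathbf{X},T}(0+)=\lim_{t\to0}f_{\mathbf{X},T}(t)$ and $f_{\mathbf{X},T}(T-)=\lim_{t\to T}f_{\mathbf{X},T}(t)$ exist in $[0,\infty]$. Assumption $\mathrm{U}_T$: $P(\Omega_T)=0$, where $\Omega_T$ is the event that $X(t_i)=\sup_{0\le t\le T}X(t)$, $i=1,2$, for at least two different $t_1,t_2\in[0,T]$. Assumption L: $K:=\lim_{\varepsilon\downarrow0}\frac{1}{\varepsilon}P\bigl(\mathbf{X}\text{ has a local maximum in }(0,\varepsilon)\bigr)<\infty$ (the limit exists). $\mathrm{TV}_{(0,T)}(f)=\sup\sum_{i=1}^{n-1}|f(s_{i+1})-f(s_i)|$ is the total variation of $f$ on $(0,T)$, the supremum being over all choices of $0<s_1<\cdots<s_n<T$. *)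

(* Defs.v *)
From HB Require Import structures.
From mathcomp Require Import all_boot all_order all_algebra.
From mathcomp Require Import all_classical all_reals all_analysis.
Set Implicit Arguments.
Unset Strict Implicit.
Unset Printing Implicit Defensive.
Import Order.TTheory GRing.Theory Num.Theory.
Import numFieldNormedType.Exports.
Local Open Scope classical_set_scope.
Local Open Scope ring_scope.

(* The library only has lower semi-continuity, for \bar R-valued functions. *)
Definition upper_semicontinuous (R : realType) (x : R -> R) : Prop :=
  lower_semicontinuous (fun t : R => (- x t)%:E).

(* A process with upper semi-continuous paths is a random element of the space
   of such paths, whose usual sigma-algebra (the Borel sets of the hypograph,
   or sup-vague, topology) is generated by the events below.  For an upper
   semi-continuous x, the event with parameters a <= b and c says that
   sup_[a,b] x >= c, and a = b gives the evaluation x a >= c. *)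
Definition hitting_sets (R : realType) : set (set (R -> R)) :=
  [set A | exists a b c : R, A = [set x | exists2 t, t \in `[a, b] & c <= x t]].
Arguments hitting_sets : clear implicits.

Definition usc_process (d : measure_display) (Omega : measurableType d)
    (R : realType) (X : Omega -> R -> R) : Prop :=
  (forall w, upper_semicontinuous (X w)) /\
  measurable_fun [set: Omega]
    (X : Omega -> g_sigma_algebraType (hitting_sets R)).

(* Shift invariance of the law of X on path space.  Invariance of the
   finite-dimensional distributions alone would not do for upper
   semi-continuous paths, because it does not determine the law of the suprema
   over intervals: X t = 1 if t = U and 0 otherwise, for an atomless random
   variable U, has finite-dimensional distributions all concentrated at 0.  For
   continuous paths the two notions agree. *)
Definition stationary (d : measure_display) (Omega : measurableType d)
    (R : realType) (P : probability Omega R) (X : Omega -> R -> R) : Prop :=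
  forall (h : R) (A : set (R -> R)), <<s hitting_sets R >> A ->
    P [set w | A (fun t => X w (t + h))] = P [set w | A (X w)].

Definition sup_locations (R : realType) (x : R -> R) (T : R) : set R :=
  [set t | t \in `[0, T] /\ x t = sup (x @` `[0, T])].

(* For an upper semi-continuous x and T >= 0 the set of locations is nonempty
   and compact, so that this infimum is a minimum. *)
Definition leftmost_sup (R : realType) (x : R -> R) (T : R) : R :=
  inf (sup_locations x T).

Definition cdf_leftmost_sup (d : measure_display) (Omega : measurableType d)
    (R : realType) (P : probability Omega R) (X : Omega -> R -> R)
    (T t : R) : R :=
  fine (P [set w | leftmost_sup (X w) T <= t]).

Definition right_derivative (R : realType) (F : R -> R) (t : R) : R :=
  lim ((F (t + h) - F t) / h @[h --> 0^'+]).

Definition density_leftmost_sup (d : measure_display) (Omega : measurableType d)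
    (R : realType) (P : probability Omega R) (X : Omega -> R -> R)
    (T : R) : R -> R :=
  right_derivative (cdf_leftmost_sup P X T).

Definition local_maximum (R : realType) (x : R -> R) (t : R) : Prop :=
  \forall s \near t, x s <= x t.

Definition assumption_L (d : measure_display) (Omega : measurableType d)
    (R : realType) (P : probability Omega R) (X : Omega -> R -> R) : Prop :=
  exists K : R,
    e^-1 * fine (P [set w | exists2 t, t \in `]0, e[ & local_maximum (X w) t])
      @[e --> 0^'+] --> K.

Definition assumption_U (d : measure_display) (Omega : measurableType d)
    (R : realType) (P : probability Omega R) (X : Omega -> R -> R)
    (T : R) : Prop :=
  P [set w | exists t1 t2 : R, [/\ t1 != t2,
       sup_locations (X w) T t1 & sup_locations (X w) T t2]] = 0%E.

(* Unlike the library's total_variation, the partition points are all in the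
   open interval, so the values at a and b play no role. *)
Definition total_variation_oo (R : realType) (a b : R) (f : R -> R) : \bar R :=
  ereal_sup [set (\sum_(0 <= i < (size s).-1) `|f s`_i.+1 - f s`_i|)%:E
            | s in [set s : seq R | sorted <%R s /\
                                    {in s, forall t, t \in `]a, b[}]].

(* Main.v *)
(* Let tau_[a,b] be the leftmost location of the supremum over [a,b] and let
   mu_T be the law of tau_[0,T].  If tau_[0,T] lies in a subinterval [c,d] then
   tau_[c,d] = tau_[0,T]; with stationarity this gives, for a cell I of length
   h = T/N of the regular grid and y(I) := mu_(T-h)(I), the bounds
   mu_T(I) <= y(I) and mu_T(I + h) <= y(I), while the total of y is at most
   mu_(T-h)(0,T-h) <= mu_T(0,T).  Since |u - v| <= 2y - u - v when u, v <= y,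
   summing over the cells bounds the variation of the masses of consecutive
   cells by the sum of the masses of the first and the last cell, which is
   O(h) by Assumption L.  Averages over blocks of cells vary no more than the
   cells do, so the same holds for the slopes of the distribution function over
   any consecutive intervals.  A family of slopes of bounded variation has
   one-sided limits, whence the right derivative f, its limits at the endpoints
   and the bound on its total variation.

   For (b), Fatou's lemma gives that f integrates to at most mu_T(0,T).  If this
   mass is 1, then tau_[0,T] is a.s. not at T, so whenever the running supremum
   of the path grows on a short interval there is a local maximum in it.  The
   expected number of cells of [T,T+delta] where it grows is then bounded
   uniformly in the mesh, which for a continuous running supremum forces that
   it does not grow at all: the suprema over [0,T] and [delta,T+delta] agree
   a.s., by Assumption U_T so do the locations that lie in both intervals, and
   mu_T is invariant under shifts inside (0,T). *)
Require Import Defs.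
From HB Require Import structures.
From mathcomp Require Import all_boot all_order all_algebra.
From mathcomp Require Import all_classical all_reals all_analysis.
From mathcomp Require Import measurable_realfun ring lra.
Set Implicit Arguments.
Unset Strict Implicit.
Unset Printing Implicit Defensive.
Import Order.TTheory GRing.Theory Num.Theory.
Import numFieldNormedType.Exports.
Local Open Scope classical_set_scope.
Local Open Scope ring_scope.

(** * Block averages and slopes over grids *)

Section BlockAverages.
Variable R : realFieldType.
Implicit Types y : nat -> R.

Definition block_average y (a b : nat) : R :=
  (\sum_(a <= k < b) y k) / (b - a)%:R.

Lemma dist_le_variation y i j : (i <= j)%N ->
  `|y j - y i| <= \sum_(i <= k < j) `|y k.+1 - y k|.
Proof. by move=> ij; rewrite -telescope_sumr //; exact: ler_norm_sum. Qed.

(** Repeating every value [m] times does not change a mean. This brings blocks of different lengths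
    to a common length, so that they can be compared position by position. *)
Lemma block_average_repeat y a b m : (a < b)%N -> (0 < m)%N ->
  block_average y a b =
  (\sum_(0 <= j < (b - a) * m) y (a + j %/ m)%N) / ((b - a) * m)%:R.
Proof.
move=> ab m0; rewrite /block_average big_nat_mul.
have inner i : \sum_(i * m <= j < i.+1 * m) y (a + j %/ m)%N = y (a + i)%N *+ m.
  rewrite (eq_big_nat _ _ (F2 := fun=> y (a + i)%N)).
    by rewrite sumr_const_nat mulSn addnK.
  move=> j /andP[ij ji]; congr (y (a + _)%N); apply/eqP.
  by rewrite eqn_leq leq_divRL // ij andbT -ltnS ltn_divLR.
under [in RHS]eq_bigr do rewrite inner addnC.
rewrite sumrMnl -[in LHS](add0n a) big_addn natrM -[_ *+ m]mulr_natr invfM mulrACA add0n.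
by rewrite divff ?mulr1// pnatr_eq0 -lt0n.
Qed.

(* The blocks are coupled: position j of a common refinement is read off in
   every block, and for each j the values read off have variation at most that
   of y. *)
Lemma variation_block_averages y (a b : nat -> nat) n N :
  (forall i, (i <= n)%N -> (a i < b i)%N) ->
  (forall i, (i < n)%N -> (b i <= a i.+1)%N) -> (b n <= N.+1)%N ->
  \sum_(0 <= i < n) `|block_average y (a i.+1) (b i.+1) -
                      block_average y (a i) (b i)|
  <= \sum_(0 <= k < N) `|y k.+1 - y k|.
Proof.
move=> ab ba bN.
(* A common multiple of all block lengths: repeating each value of block [i] exactly [m i] times
   fills [p] positions, and [c i j] is the index read at position [j]. *)
pose p := (\prod_(i < n.+1) (b i - a i))%N.
pose m i := (p %/ (b i - a i))%N.
have p0 : (0 < p)%N by apply: prodn_gt0 => i; rewrite subn_gt0 ab// -ltnS.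
have pm i : (i <= n)%N -> ((b i - a i) * m i)%N = p.
  move=> i_n; rewrite /m mulnC divnK //.
  by rewrite /p (bigD1 (Ordinal (i_n : (i < n.+1)%N))) //= dvdn_mulr.
have m0 i : (i <= n)%N -> (0 < m i)%N.
  by move=> i_n; move: p0; rewrite -(pm _ i_n) muln_gt0 => /andP[].
pose c i j := (a i + j %/ m i)%N.
have avgE i : (i <= n)%N ->
    block_average y (a i) (b i) = (\sum_(0 <= j < p) y (c i j)) / p%:R.
  by move=> i_n; rewrite (@block_average_repeat _ _ _ (m i)) ?ab ?m0// pm.
have c_lt i j : (i <= n)%N -> (j < p)%N -> (c i j < b i)%N.
  by move=> i_n jp; rewrite /c -ltn_subRL ltn_divLR ?m0// pm.
have c_le i j : (i < n)%N -> (j < p)%N -> (c i j <= c i.+1 j)%N.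
  move=> i_n jp; apply: leq_trans (ltnW (c_lt _ _ (ltnW i_n) jp)) _.
  exact: leq_trans (ba _ i_n) (leq_addr _ _).
have step i : (i < n)%N -> `|block_average y (a i.+1) (b i.+1) -
    block_average y (a i) (b i)| <=
    (\sum_(0 <= j < p) \sum_(c i j <= k < c i.+1 j) `|y k.+1 - y k|) / p%:R.
  move=> i_n; rewrite !avgE ?(ltnW i_n)// -mulrBl -sumrB normrM normfV normr_nat.
  rewrite ler_wpM2r ?invr_ge0//; apply: le_trans (ler_norm_sum _ _ _) _.
  rewrite !big_nat; apply: ler_sum => j /andP[_ jp].
  exact/dist_le_variation/c_le.
have chain j q : (j < p)%N -> (q <= n)%N ->
    \sum_(0 <= i < q) \sum_(c i j <= k < c i.+1 j) `|y k.+1 - y k|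
    <= \sum_(0 <= k < c q j) `|y k.+1 - y k|.
  move=> jp; elim: q => [|q IH] qn.
    by rewrite big_geq//; apply: sumr_ge0.
  rewrite big_nat_recr//= [leRHS](big_cat_nat (leq0n _) (c_le _ _ qn jp))/=.
  by rewrite lerD2r IH// ltnW.
apply: (@le_trans _ _ (\sum_(0 <= i < n)
    (\sum_(0 <= j < p) \sum_(c i j <= k < c i.+1 j) `|y k.+1 - y k|) / p%:R)).
  by rewrite !big_nat; apply: ler_sum => i /andP[_ ?]; exact: step.
rewrite -mulr_suml exchange_big/= ler_pdivrMr ?ltr0n//.
set V := (X in _ <= X * _); have -> : V * p%:R = \sum_(0 <= j < p) V.
  by rewrite sumr_const_nat subn0 mulr_natr.
rewrite [leLHS]big_nat [leRHS]big_nat; apply: ler_sum => j /andP[_ jp].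
apply: le_trans (chain j n jp (leqnn _)) _.
have cN : (c n j <= N)%N by rewrite -ltnS (leq_trans _ bN)// c_lt.
by rewrite /V [leRHS](big_cat_nat (leq0n _) cN)//= lerDl; apply: sumr_ge0.
Qed.

End BlockAverages.

Lemma cvg_div_natS (R : realType) (c : R) :
  c / N.+1%:R @[N --> \oo] --> (0 : R).
Proof.
by rewrite -[X in _ --> X](mulr0 c); apply: cvgMr; exact: cvg_harmonic.
Qed.

Lemma cvg_div_natS_right (R : realType) (c : R) : 0 < c ->
  c / N.+1%:R @[N --> \oo] --> (0 : R)^'+.
Proof.
move=> c_gt0 A [e e_gt0 eA].
suff : \forall N \near \oo, A (c / N.+1%:R) by [].
near=> N; have cN : 0 < c / N.+1%:R by exact: divr_gt0.
apply: eA => //=; rewrite sub0r normrN gtr0_norm//.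
by near: N; exact: cvgr_lt (cvg_div_natS c) _ _.
Unshelve. all: by end_near. Qed.

Definition slope (R : realType) (G : R -> R) (s t : R) : R :=
  (G t - G s) / (t - s).

(** Below, the number of cells is always of the form [N.+1], so that the cell length is positive. *)
Definition grid (R : realType) (T : R) (N k : nat) : R := k%:R * (T / N%:R).

Definition grid_slope (R : realType) (G : R -> R) (T : R) (N k : nat) : R :=
  slope G (grid T N k) (grid T N k.+1).

Section Grid.
Variables (R : realType) (T : R).
Hypothesis T_gt0 : 0 < T.

Lemma grid_cell_gt0 N : 0 < T / N.+1%:R.
Proof. exact: divr_gt0. Qed.

Lemma gridS N k : grid T N.+1 k.+1 = grid T N.+1 k + T / N.+1%:R.
Proof. by rewrite /grid -natr1 mulrDl mul1r. Qed.

Lemma gridB N k : grid T N.+1 k.+1 - grid T N.+1 k = T / N.+1%:R.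
Proof. by rewrite gridS addrAC subrr add0r. Qed.

Lemma gridN N : grid T N.+1 N.+1 = T.
Proof. by rewrite /grid mulrCA divff ?mulr1// pnatr_eq0. Qed.

Lemma grid_ge0 N k : 0 <= grid T N.+1 k.
Proof. by rewrite mulr_ge0// ltW// grid_cell_gt0. Qed.

Lemma grid_le N k j : (k <= j)%N -> grid T N.+1 k <= grid T N.+1 j.
Proof. by move=> kj; rewrite ler_pM2r ?grid_cell_gt0// ler_nat. Qed.

Lemma grid_leT N k : (k <= N)%N -> grid T N.+1 k.+1 <= T.
Proof. by move=> kN; rewrite -[leRHS](gridN N); exact: grid_le. Qed.

End Grid.

(** * Variation of slopes over arbitrary consecutive intervals *)

Section SlopeVariation.
Variables (R : realType) (G : R -> R) (T C : R).
Hypothesis T_gt0 : 0 < T.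
Hypothesis G_lip : forall s t : R, 0 <= s -> s <= t -> t <= T ->
  0 <= G t - G s <= C * (t - s).
Hypothesis G_grid : forall N,
  \sum_(0 <= k < N) `|grid_slope G T N.+1 k.+1 - grid_slope G T N.+1 k|
  <= grid_slope G T N.+1 0 + grid_slope G T N.+1 N.

(** All cells have the same length, so a mean of consecutive cell slopes telescopes to the slope
    over their union. *)
Lemma block_average_grid_slope N a b : (a < b)%N ->
  block_average (grid_slope G T N.+1) a b =
  slope G (grid T N.+1 a) (grid T N.+1 b).
Proof.
move=> ab; rewrite /block_average /slope /grid -mulrBl -natrB ?(ltnW ab)//.
have: T / N.+1%:R != 0 by rewrite gt_eqF// divr_gt0.
rewrite /grid_slope /slope /grid; move: (T / _) => h h0.
rewrite (eq_bigr (fun k => (G (k.+1%:R * h) - G (k%:R * h)) / h)); last first.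
  move=> k _; congr (_ / _).
  by rewrite -mulrBl -natr1; ring.
rewrite -mulr_suml (@telescope_sumr _ a b (fun k => G (k%:R * h))) ?(ltnW ab)//.
by rewrite invfM mulrAC -mulrA.
Qed.

(** Rounding down to the grid: [c N t] is the index of the cell that contains [t], and [r N t] is
    its left end, less than one cell length below [t]. *)
Let c N t : nat := Num.truncn (t / (T / N.+1%:R)).
Let r N t := grid T N.+1 (c N t).

Let step_gt0 := grid_cell_gt0 T_gt0.

Let r_itv N t : 0 <= t -> t - T / N.+1%:R < r N t <= t.
Proof.
move=> t0; have := @truncn_itv R (t / (T / N.+1%:R)).
rewrite divr_ge0 ?(ltW (step_gt0 _))// => /(_ isT).
rewrite ler_pdivlMr ?step_gt0// ltr_pdivrMr ?step_gt0// => /andP[h1 h2].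
rewrite /r /grid h1 andbT ltrBlDr; apply: lt_le_trans h2 _.
by rewrite -natr1 mulrDl mul1r.
Qed.

Let r_ge0 N t : 0 <= r N t.
Proof. exact: grid_ge0. Qed.

Let cvg_step := @cvg_div_natS R T.

Let r_cvg t : 0 <= t -> r N t @[N --> \oo] --> t.
Proof.
move=> t0; apply: (@squeeze_cvgr _ _ _ _ (fun N => t - T / N.+1%:R) (cst t)).
- by near=> N; have /andP[/ltW -> ->] := r_itv N t0.
- by rewrite -[X in _ --> X]subr0; apply: cvgB => //; exact: cvg_cst.
- exact: cvg_cst.
Unshelve. all: by end_near. Qed.

Let Gr_cvg t : 0 <= t -> t <= T -> G (r N t) @[N --> \oo] --> G t.
Proof.
move=> t0 tT.
apply: (@squeeze_cvgr _ _ _ _ (fun N => G t - C * (t - r N t)) (cst (G t))).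
- near=> N; have /andP[_ rt] := r_itv N t0.
  have /andP[] := G_lip (r_ge0 N t) rt tT; rewrite /cst /=; lra.
- rewrite -[X in _ --> X]subr0; apply: cvgB; first exact: cvg_cst.
  rewrite -[X in _ --> X](mulr0 C) -(subrr t); apply: cvgMr.
  by apply: cvgB; [exact: cvg_cst|exact: r_cvg].
- exact: cvg_cst.
Unshelve. all: by end_near. Qed.

Let slope_r_cvg s t : 0 <= s -> s < t -> t <= T ->
  slope G (r N s) (r N t) @[N --> \oo] --> slope G s t.
Proof.
move=> s0 st tT; have t0 := le_trans s0 (ltW st).
apply: cvgM; first by apply: cvgB; apply: Gr_cvg => //; lra.
apply: cvgV; first by rewrite subr_eq0 gt_eqF.
by apply: cvgB; exact: r_cvg.
Qed.

Let c_lt s t : 0 <= s -> s < t -> \forall N \near \oo, (c N s < c N t)%N.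
Proof.
move=> s0 st; have d0 : 0 < t - s by rewrite subr_gt0.
near=> N.
have t0 := le_trans s0 (ltW st).
have h : T / N.+1%:R < t - s by near: N; exact: cvgr_lt cvg_step _ d0.
rewrite -(ltr_nat R) -(ltr_pM2r (step_gt0 N)).
have /andP[_] := r_itv N s0; have /andP[+ _] := r_itv N t0; rewrite /r /grid.
by move: (T / _) h => h; lra.
Unshelve. all: by end_near. Qed.

(** Once the end points are rounded down to a fine grid, the slopes are block averages of cell
    slopes and [G_grid] bounds their variation; then the mesh tends to 0. Rounding preserves
    [b i <= a i.+1], and [a i < b i] survives for large [N]. The bound [M] has to hold only
    eventually, so any number above the limit of the end slopes will do. *)
Lemma variation_slopes (M : R) (a b : nat -> R) n :
  (forall i, (i <= n)%N -> [/\ 0 <= a i, a i < b i & b i <= T]) ->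
  (forall i, (i < n)%N -> b i <= a i.+1) ->
  (\forall N \near \oo, grid_slope G T N.+1 0 + grid_slope G T N.+1 N <= M) ->
  \sum_(0 <= i < n) `|slope G (a i.+1) (b i.+1) - slope G (a i) (b i)| <= M.
Proof.
move=> ab ba hM.
pose S N := \sum_(0 <= i < n) `|slope G (r N (a i.+1)) (r N (b i.+1)) -
  slope G (r N (a i)) (r N (b i))|.
apply: (@ler_cvg_to _ \oo _ R S (cst M)); last 1 first.
- have all_lt : \forall N \near \oo,
      forall i : 'I_n.+1, (c N (a i) < c N (b i))%N.
    apply: filter_forall => i.
    have i_n : (i <= n)%N by rewrite -ltnS.
    by have [? ? _] := ab i i_n; exact: c_lt.
  near=> N; rewrite /S /cst.
  have lt_c i : (i <= n)%N -> (c N (a i) < c N (b i))%N.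
    move=> i_n; have H : forall i : 'I_n.+1, (c N (a i) < c N (b i))%N.
      by near: N.
    exact: (H (Ordinal (i_n : (i < n.+1)%N))).
  have := @variation_block_averages R (grid_slope G T N.+1) (fun i => c N (a i))
    (fun i => c N (b i)) n N lt_c.
  have hb i : (i < n)%N -> (c N (b i) <= c N (a i.+1))%N.
    move=> i_n; apply: le_truncn.
    by rewrite ler_pM2r ?invr_gt0 ?step_gt0// ba.
  have hN : (c N (b n) <= N.+1)%N.
    have [a0 abn bT] := ab n (leqnn _).
    have := truncn_le (b n / (T / N.+1%:R)).
    rewrite divr_ge0 ?(ltW (step_gt0 _)) ?(le_trans a0 (ltW abn))// => h.
    rewrite -(ler_nat R); apply: le_trans h _.
    by rewrite ler_pdivrMr ?step_gt0// mulrCA divff ?mulr1// pnatr_eq0.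
  move=> /(_ hb hN) V.
  apply: le_trans (_ : grid_slope G T N.+1 0 + grid_slope G T N.+1 N <= _).
    apply: le_trans (G_grid N); apply: le_trans V.
    rewrite !big_nat le_eqVlt; apply/orP; left; apply/eqP.
    apply: eq_bigr => i /andP[_ i_n].
    by rewrite !block_average_grid_slope ?lt_c// ltnW.
  by near: N.
- rewrite /S big_nat; under eq_fun do rewrite big_nat.
  apply: cvg_big => [|i /andP[_ i_n]]; first exact: add_continuous.
  have [? ? ?] := ab _ (ltnW i_n); have [? ? ?] := ab _ i_n.
  by apply: cvg_norm; apply: cvgB; exact: slope_r_cvg.
- exact: cvg_cst.
Unshelve. all: by end_near. Qed.

End SlopeVariation.

(** * One-sided limits of slopes *)

(** A Cauchy criterion along the sets [B d] as [d] shrinks. If it failed for some [e], every [K]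
    would have a successor for [prec] at which [q] has moved by at least [e], and the resulting
    chain would have unbounded variation. *)
Lemma cvg_of_chain_variation (R : realType) (I : Type) (q : I -> R)
    (B : R -> set I) (prec : I -> I -> Prop) (d0 M : R) :
  {homo B : d d' / d <= d' >-> d `<=` d'} -> (forall d, 0 < d -> B d !=set0) ->
  0 < d0 ->
  (forall K, B d0 K -> exists2 d, 0 < d & forall K', B d K' -> prec K K') ->
  (forall (K : nat -> I) n, (forall i, B d0 (K i)) ->
     (forall i, prec (K i) (K i.+1)) ->
     \sum_(0 <= i < n) `|q (K i.+1) - q (K i)| <= M) ->
  exists l, forall e, 0 < e ->
    exists2 d, 0 < d & forall K, B d K -> `|q K - l| <= e.
Proof.
move=> Bhomo B0 d0_gt0 Bprec chainM.
pose F : set_system I := [set A | exists2 d, 0 < d & B d `<=` A].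
have FF : ProperFilter F.
  split; first by move=> [d /B0[K BK] /(_ K BK)].
  split; first by exists 1.
    move=> A A' [d d_gt0 dA] [d' d'_gt0 dA']; exists (Order.min d d').
      by rewrite lt_min d_gt0.
    move=> K BK; split; [apply: dA|apply: dA'].
      by apply: Bhomo BK; rewrite ge_min lexx.
    by apply: Bhomo BK; rewrite ge_min lexx orbT.
  by move=> A A' AA' [d d_gt0 dA]; exists d => // K /dA /AA'.
suff /cvg_ex[l ql] : cvg (q @ F).
  exists l => e e_gt0.
  have [d d_gt0 dl] : F [set K | `|l - q K| <= e] by exact: cvgr_dist_le ql _ _.
  by exists d => // K /dl /=; rewrite distrC.
apply: cauchy_cvg; apply: cauchy_exP => e e_gt0; apply: contrapT => no.
(* If no later element were [e] away from [q K], a small set [B d] would be mapped into the ball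
   around [q K], against the assumed failure. *)
have next (K : {K | B d0 K}) : exists K' : {K | B d0 K},
    prec (sval K) (sval K') /\ e <= `|q (sval K') - q (sval K)|.
  case: K => K BK /=; have [d d_gt0 dK] := Bprec _ BK.
  apply: contrapT => noK; apply: no; exists (q K).
  exists (Order.min d d0); first by rewrite lt_min d_gt0.
  move=> K' BK'; rewrite /= -ball_normE /=.
  have BK'0 : B d0 K' by apply: Bhomo BK'; rewrite ge_min lexx orbT.
  have BK'd : B d K' by apply: Bhomo BK'; rewrite ge_min lexx.
  rewrite ltNge distrC; apply/negP => le_e; apply: noK.
  by exists (exist _ K' BK'0); split => //; exact: dK.
have [nxt nxtP] := choice next.
have [K0 BK0] := B0 _ d0_gt0.
pose K i := sval (iter i nxt (exist _ K0 BK0)).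
(* More than [M / e] jumps of size at least [e] exceed [M]. *)
have := chainM K (Num.truncn (M / e)).+1.
move=> /(_ (fun i => svalP _) (fun i => (nxtP _).1)).
apply/negP; rewrite -ltNge.
apply: lt_le_trans (_ : e *+ (Num.truncn (M / e)).+1 <= _).
  by rewrite -mulr_natr mulrC -ltr_pdivrMr// truncnS_gt.
rewrite -[X in _ *+ X]subn0 -sumr_const_nat; apply: ler_sum => i _.
exact: (nxtP _).2.
Qed.

(** Both end points approach [t] from the right. This is stronger than a right derivative at [t] for
    continuous [G]: it also controls the derivatives at the points just after [t], hence the limits
    of the density. *)
Definition right_slope_limit (R : realType) (G : R -> R) (t l : R) : Prop :=
  forall e, 0 < e -> exists2 d, 0 < d &
    forall s u, t < s -> s < u -> u < t + d -> `|slope G s u - l| <= e.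

Definition left_slope_limit (R : realType) (G : R -> R) (t l : R) : Prop :=
  forall e, 0 < e -> exists2 d, 0 < d &
    forall s u, t - d < s -> s < u -> u < t -> `|slope G s u - l| <= e.

Section SlopeLimits.
Variables (R : realType) (G : R -> R) (T C : R).
Hypothesis T_gt0 : 0 < T.
Hypothesis G_lip : forall s t : R, 0 <= s -> s <= t -> t <= T ->
  0 <= G t - G s <= C * (t - s).
Hypothesis G_grid : forall N,
  \sum_(0 <= k < N) `|grid_slope G T N.+1 k.+1 - grid_slope G T N.+1 k|
  <= grid_slope G T N.+1 0 + grid_slope G T N.+1 N.

Lemma slope_bounded s t : 0 <= s -> s < t -> t <= T -> 0 <= slope G s t <= C.
Proof.
move=> s0 st tT; have d0 : 0 < t - s by rewrite subr_gt0.
have /andP[h1 h2] := G_lip s0 (ltW st) tT.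
by rewrite /slope divr_ge0 ?(ltW d0)//= ler_pdivrMr.
Qed.

Let grid_itv N k : (k <= N)%N ->
  [/\ 0 <= grid T N.+1 k, grid T N.+1 k < grid T N.+1 k.+1 &
      grid T N.+1 k.+1 <= T].
Proof.
by move=> kN; split; [exact: grid_ge0|rewrite gridS ltrDl divr_gt0|exact: grid_leT].
Qed.

(** A crude bound, available before the end slopes are known to converge: the Lipschitz constant
    bounds each of them. It serves only to produce the limits. *)
Lemma variation_slopes_bounded (a b : nat -> R) n :
  (forall i, (i <= n)%N -> [/\ 0 <= a i, a i < b i & b i <= T]) ->
  (forall i, (i < n)%N -> b i <= a i.+1) ->
  \sum_(0 <= i < n) `|slope G (a i.+1) (b i.+1) - slope G (a i) (b i)| <= C + C.
Proof.
move=> ab ba; apply: (variation_slopes T_gt0 G_lip G_grid ab ba).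
near=> N; apply: lerD.
  by have [h1 h2 h3] := grid_itv (leq0n N); have /andP[_] := slope_bounded h1 h2 h3.
by have [h1 h2 h3] := grid_itv (leqnn N); have /andP[_] := slope_bounded h1 h2 h3.
Unshelve. all: by end_near. Qed.

Lemma right_slope_limit_ex t : 0 <= t -> t < T ->
  exists l, right_slope_limit G t l.
Proof.
move=> t0 tT.
pose B d : set (R * R) := [set K | [/\ t < K.1, K.1 < K.2 & K.2 < t + d]].
have [|d d_gt0||K [K1 K2 K3]|K n BK prec|l lP] := @cvg_of_chain_variation R _
    (fun K => slope G K.1 K.2) B (fun K K' => K'.2 <= K.1) (T - t) (C + C).
- by move=> d d' dd' K [K1 K2 K3]; split => //; lra.
- by exists (t + d / 3, t + d / 2); split => /=; lra.
- by lra.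
- by exists (K.1 - t); [lra|move=> K' [K'1 K'2 K'3]; lra].
(* The chain moves leftwards to [t], whereas the variation bound expects increasing intervals; hence
   the sum is reversed. *)
- rewrite big_nat_rev /= add0n.
  rewrite (eq_big_nat _ _ (F2 := fun i => `|slope G (K (n - i.+1)%N).1 (K (n - i.+1)%N).2 - slope G (K (n - i)%N).1 (K (n - i)%N).2|)); last first.
    by move=> i /andP[_ i_n]; rewrite -subSn// subSS distrC.
  apply: (@variation_slopes_bounded (fun i => (K (n - i)%N).1)
    (fun i => (K (n - i)%N).2)) => i i_n.
    by have [? ? ?] := BK (n - i)%N; split; lra.
  by rewrite -[in leLHS](subnSK i_n); exact: prec.
exists l => e /lP[d d_gt0 dl]; exists d => // s u ts su ud.
exact: (dl (s, u)).
Qed.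

Lemma left_slope_limit_ex t : 0 < t -> t <= T -> exists l, left_slope_limit G t l.
Proof.
move=> t0 tT.
pose B d : set (R * R) := [set K | [/\ t - d < K.1, K.1 < K.2 & K.2 < t]].
have [|d d_gt0||K [K1 K2 K3]|K n BK prec|l lP] := @cvg_of_chain_variation R _
    (fun K => slope G K.1 K.2) B (fun K K' => K.2 <= K'.1) t (C + C).
- by move=> d d' dd' K [K1 K2 K3]; split => //; lra.
- by exists (t - d / 2, t - d / 3); split => /=; lra.
- by lra.
- by exists (t - K.2); [lra|move=> K' [K'1 K'2 K'3]; lra].
- apply: (@variation_slopes_bounded (fun i => (K i).1) (fun i => (K i).2)) => i _.
    by have [? ? ?] := BK i; split; lra.
  exact: prec.
exists l => e /lP[d d_gt0 dl]; exists d => // s u ts su ud.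
exact: (dl (s, u)).
Qed.

Let G_right_cvg t : 0 <= t -> t < T -> G s @[s --> t^'+] --> G t.
Proof.
move=> t0 tT.
apply: (@squeeze_cvgr _ _ _ _ (cst (G t)) (fun s => G t + C * (s - t))).
- near=> s.
  have st : t < s by near: s; exact: nbhs_right_gt.
  have sT : s < T by near: s; exact: nbhs_right_lt.
  have /andP[] := G_lip t0 (ltW st) (ltW sT); rewrite /cst; lra.
- exact: cvg_cst.
- rewrite -[X in _ --> X]addr0 -(mulr0 C) -(subrr t).
  apply: cvgD; first exact: cvg_cst.
  apply: cvgMr; apply: cvgB; last exact: cvg_cst.
  exact: cvg_at_right_filter.
Unshelve. all: by end_near. Qed.

Let G_left_cvg t : 0 < t -> t <= T -> G s @[s --> t^'-] --> G t.
Proof.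
move=> t0 tT.
apply: (@squeeze_cvgr _ _ _ _ (fun s => G t - C * (t - s)) (cst (G t))).
- near=> s.
  have st : s < t by near: s; exact: nbhs_left_lt.
  have s0 : 0 < s by near: s; exact: nbhs_left_gt.
  have /andP[] := G_lip (ltW s0) (ltW st) tT; rewrite /cst; lra.
- rewrite -[X in _ --> X]subr0 -(mulr0 C) -(subrr t).
  apply: cvgB; first exact: cvg_cst.
  apply: cvgMr; apply: cvgB; first exact: cvg_cst.
  exact: cvg_at_left_filter.
- exact: cvg_cst.
Unshelve. all: by end_near. Qed.

(** The left end point of the interval is moved down to [t]: [G] is right continuous there and the
    bound by [e] is a closed condition. *)
Lemma right_slope_limit_cvg t l : 0 <= t -> t < T -> right_slope_limit G t l ->
  slope G t (t + h) @[h --> 0^'+] --> l.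
Proof.
move=> t0 tT lP; apply/cvgrPdist_le => e /lP[d d_gt0 dl].
near=> h.
have h0 : 0 < h by near: h; exact: nbhs_right_gt.
have hd : h < d by near: h; exact: nbhs_right_lt.
rewrite distrC.
apply: (@ler_cvg_to _ t^'+ _ R (fun s => `|slope G s (t + h) - l|) (cst e)).
- apply: cvg_norm; apply: cvgB; last exact: cvg_cst.
  apply: cvgM; first by apply: cvgB; [exact: cvg_cst|exact: G_right_cvg].
  apply: cvgV; first by rewrite gt_eqF//; lra.
  by apply: cvgB; [exact: cvg_cst|exact: cvg_at_right_filter].
- exact: cvg_cst.
- near=> s; apply: dl.
  + by near: s; exact: nbhs_right_gt.
  + by near: s; apply: nbhs_right_lt; lra.
  + lra.
Unshelve. all: by end_near. Qed.

Lemma left_slope_limit_cvg t l : 0 < t -> t <= T -> left_slope_limit G t l ->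
  slope G (t - h) t @[h --> 0^'+] --> l.
Proof.
move=> t0 tT lP; apply/cvgrPdist_le => e /lP[d d_gt0 dl].
near=> h.
have h0 : 0 < h by near: h; exact: nbhs_right_gt.
have hd : h < d by near: h; exact: nbhs_right_lt.
rewrite distrC.
apply: (@ler_cvg_to _ t^'- _ R (fun s => `|slope G (t - h) s - l|) (cst e)).
- apply: cvg_norm; apply: cvgB; last exact: cvg_cst.
  apply: cvgM; first by apply: cvgB; [exact: G_left_cvg|exact: cvg_cst].
  apply: cvgV; first by rewrite gt_eqF//; lra.
  by apply: cvgB; [exact: cvg_at_left_filter|exact: cvg_cst].
- exact: cvg_cst.
- near=> s; apply: dl.
  + lra.
  + by near: s; apply: nbhs_left_gt; lra.
  + by near: s; exact: nbhs_left_lt.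
Unshelve. all: by end_near. Qed.

End SlopeLimits.

(** * End point limits and total variation of the right derivative *)

Section DensityVariation.
Variables (R : realType) (G : R -> R) (T C : R).
Hypothesis T_gt0 : 0 < T.
Hypothesis G_lip : forall s t : R, 0 <= s -> s <= t -> t <= T ->
  0 <= G t - G s <= C * (t - s).
Hypothesis G_grid : forall N,
  \sum_(0 <= k < N) `|grid_slope G T N.+1 k.+1 - grid_slope G T N.+1 k|
  <= grid_slope G T N.+1 0 + grid_slope G T N.+1 N.
Variables (f : R -> R) (f0 fT : R).
Hypothesis f_lim : forall t, 0 < t < T -> right_slope_limit G t (f t).
Hypothesis f0_lim : right_slope_limit G 0 f0.
Hypothesis fT_lim : left_slope_limit G T fT.

Let f_cvg t : 0 < t < T -> slope G t (t + h) @[h --> 0^'+] --> f t.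
Proof.
move=> /andP[t0 tT]; apply: (right_slope_limit_cvg G_lip) => //.
  exact: ltW.
by apply: f_lim; rewrite t0.
Qed.

(** [f t] is a limit of slopes over [[t, t + h]], and for small [t] and [h] these already lie within
    [e] of [f0]. *)
Lemma density_cvg_right : f t @[t --> 0^'+] --> f0.
Proof.
apply/cvgrPdist_le => e /f0_lim[d d_gt0 dl]; near=> t.
have t0 : 0 < t by near: t; exact: nbhs_right_gt.
have tT : t < T by near: t; exact: nbhs_right_lt.
have td : t < d by near: t; exact: nbhs_right_lt.
rewrite distrC.
apply: (@ler_cvg_to _ 0^'+ _ R (fun h => `|slope G t (t + h) - f0|) (cst e)).
- by apply: cvg_norm; apply: cvgB; [apply: f_cvg; rewrite t0|exact: cvg_cst].
- exact: cvg_cst.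
- near=> h; have h0 : 0 < h by near: h; exact: nbhs_right_gt.
  have hd : h < d - t by near: h; apply: nbhs_right_lt; lra.
  by rewrite /cst; apply: dl; lra.
Unshelve. all: by end_near. Qed.

Lemma density_cvg_left : f t @[t --> T^'-] --> fT.
Proof.
apply/cvgrPdist_le => e /fT_lim[d d_gt0 dl]; near=> t.
have tT : t < T by near: t; exact: nbhs_left_lt.
have t0 : 0 < t by near: t; exact: nbhs_left_gt.
have td : T - d < t by near: t; apply: nbhs_left_gt; lra.
rewrite distrC.
apply: (@ler_cvg_to _ 0^'+ _ R (fun h => `|slope G t (t + h) - fT|) (cst e)).
- by apply: cvg_norm; apply: cvgB; [apply: f_cvg; rewrite t0|exact: cvg_cst].
- exact: cvg_cst.
- near=> h; have h0 : 0 < h by near: h; exact: nbhs_right_gt.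
  have hd : h < T - t by near: h; apply: nbhs_right_lt; lra.
  by rewrite /cst; apply: dl; lra.
Unshelve. all: by end_near. Qed.

Let step_cvg := cvg_div_natS_right T_gt0.

Let end_slopes_cvg :
  grid_slope G T N.+1 0 + grid_slope G T N.+1 N @[N --> \oo] --> f0 + fT.
Proof.
apply: cvgD.
  have := right_slope_limit_cvg G_lip (lexx 0) T_gt0 f0_lim.
  move=> /(cvg_comp _ _ step_cvg); apply: cvg_trans; apply: near_eq_cvg.
  by near=> N; rewrite /grid_slope /grid /= mul0r mul1r add0r.
have := left_slope_limit_cvg G_lip T_gt0 (lexx T) fT_lim.
move=> /(cvg_comp _ _ step_cvg); apply: cvg_trans; apply: near_eq_cvg.
near=> N; rewrite /grid_slope /grid /=; congr slope; last first.
  by rewrite mulrCA divff ?mulr1// pnatr_eq0.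
rewrite -[X in X - _](mulfVK (_ : N.+1%:R != 0)) ?pnatr_eq0// -natr1.
by ring.
Unshelve. all: by end_near. Qed.

(** Each [f s_i] is approximated by the slope over [[s_i, s_i + h]]. For [h] below all gaps of the
    partition these intervals are consecutive, so their slopes vary by at most [f0 + fT + e]; then
    [h] and [e] tend to 0. *)
Lemma total_variation_density_le :
  (total_variation_oo 0 T f <= (f0 + fT)%:E)%E.
Proof.
apply: ge_ereal_sup => _ [s [s_sorted s_itv] <-]; rewrite lee_fin.
apply/ler_addgt0Pr => e e_gt0.
have end_le : \forall N \near \oo,
    grid_slope G T N.+1 0 + grid_slope G T N.+1 N <= f0 + fT + e.
  by apply: cvgr_le end_slopes_cvg _ _; rewrite ltrDl.
set n := (size s).-1.
(* For the empty partition only nonnegativity of the bound is at stake, and it follows from the grid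
   inequality. *)
have [s0|s_gt0] := posnP (size s).
  rewrite /n s0 big_geq//.
  have [N _ hN] := end_le.
  apply: le_trans (hN N (leqnn N)).
  by apply: le_trans (G_grid N); apply: sumr_ge0.
have sn : size s = n.+1 by rewrite prednK.
have s_in i : (i <= n)%N -> 0 < s`_i < T.
  by move=> i_n; have := s_itv s`_i; rewrite in_itv/=; apply; rewrite mem_nth// sn.
have s_lt i : (i < n)%N -> s`_i < s`_i.+1.
  move=> i_n; have := @sorted_ltn_nth _ _ lt_trans 0 s s_sorted i i.+1.
  by rewrite !inE sn !ltnS; apply => //; exact: ltnW.
apply: (@ler_cvg_to _ 0^'+ _ R (fun h => \sum_(0 <= i < n)
   `|slope G s`_i.+1 (s`_i.+1 + h) - slope G s`_i (s`_i + h)|)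
   (cst (f0 + fT + e))).
- rewrite big_nat; under eq_fun do rewrite big_nat.
  apply: cvg_big => [|i /andP[_ i_n]]; first exact: add_continuous.
  by apply: cvg_norm; apply: cvgB; apply: f_cvg; apply: s_in => //; exact: ltnW.
- exact: cvg_cst.
- have gap : \forall h \near 0^'+, forall i : 'I_n, h < s`_i.+1 - s`_i.
    by apply: filter_forall => i; apply: nbhs_right_lt; rewrite subr_gt0 s_lt.
  near=> h.
  have h0 : 0 < h by near: h; exact: nbhs_right_gt.
  have hT : h < T - s`_n.
    by near: h; apply: nbhs_right_lt; have := s_in n (leqnn n); lra.
  have hgap i : (i < n)%N -> s`_i + h <= s`_i.+1.
    move=> i_n; have H : forall i : 'I_n, h < s`_i.+1 - s`_i by near: h.
    by have := H (Ordinal i_n); rewrite /=; lra.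
  apply: (variation_slopes T_gt0 G_lip G_grid) => // i i_n.
  have /andP[? ?] := s_in _ i_n; split; [exact: ltW|lra|].
  move: i_n; rewrite leq_eqVlt => /predU1P[->|i_n]; first lra.
  have /andP[? ?] := s_in _ i_n.
  by have := hgap _ i_n; lra.
Unshelve. all: by end_near. Qed.

End DensityVariation.

(** * The integral of the right derivative *)

Section DensityIntegral.
Variables (R : realType) (G : R -> R) (T C : R).
Hypothesis T_gt0 : 0 < T.
Hypothesis G_lip : forall s t : R, 0 <= s -> s <= t -> t <= T ->
  0 <= G t - G s <= C * (t - s).
Variable f : R -> R.
Hypothesis f_lim : forall t, 0 < t < T -> right_slope_limit G t (f t).

Local Notation mu := (@lebesgue_measure R).

(* On each cell, the slope over the next cell: these step functions converge
   to the right derivative at every point, continuity point or not. *)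
Let step N (t : R) : \bar R := (\sum_(k < N)
  (grid_slope G T N.+1 k.+1 * \1_`[grid T N.+1 k, grid T N.+1 k.+1[%classic t)%:E)%E.

Let cell_gt0 := grid_cell_gt0 T_gt0.

Let slope_ge0 N k : (k <= N)%N -> 0 <= grid_slope G T N.+1 k.
Proof.
move=> kN; rewrite /grid_slope /slope gridB; apply: divr_ge0; last exact: ltW.
by have /andP[] := G_lip (grid_ge0 T_gt0 N k) (grid_le T_gt0 N (leqnSn k))
  (grid_leT T_gt0 kN).
Qed.

Let term_ge0 N (k : 'I_N) t : (0 <= (grid_slope G T N.+1 k.+1 *
  \1_`[grid T N.+1 k, grid T N.+1 k.+1[%classic t)%:E)%E.
Proof. by rewrite lee_fin mulr_ge0// slope_ge0. Qed.

Let integral_step N : (\int[mu]_(t in `]0%R, T[) step N t <= (G T - G 0)%:E)%E.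
Proof.
rewrite ge0_integral_sum//; last first.
  by move=> k; apply/measurable_EFinP; apply: measurable_funM.
apply: (@le_trans _ _ (\sum_(k < N)
    (G (grid T N.+1 k.+2) - G (grid T N.+1 k.+1))%:E)%E).
  apply: lee_sum => k _.
  set A := [set` `[grid T N.+1 k, _[]; set q := grid_slope _ _ _ _.
  have -> : (\int[mu]_(t in `]0%R, T[) (q * \1_A t)%:E =
      q%:E * \int[mu]_(t in `]0%R, T[) (\1_A t)%:E)%E.
    under eq_integral do rewrite EFinM.
    rewrite ge0_integralZl_EFin//; last 2 first.
    - by apply/measurable_EFinP; apply: measurable_indic; exact: measurable_itv.
    - by rewrite /q slope_ge0.
  rewrite integral_indic//; last exact: measurable_itv.
  apply: (@le_trans _ _ (q%:E * (T / N.+1%:R)%:E)%E).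
    apply: lee_wpmul2l; first by rewrite lee_fin slope_ge0.
    apply: le_trans (le_measure _ _ _ (@subIsetl _ _ _)) _; rewrite ?inE//.
      by apply: measurableI; exact: measurable_itv.
      exact: measurable_itv.
    by rewrite /= lebesgue_measure_itv/= lte_fin gridS ltrDl cell_gt0 -EFinD addrAC subrr add0r.
  by rewrite -EFinM lee_fin /q /grid_slope /slope gridB divfK// gt_eqF.
(* The increments telescope from the first interior grid point on; the omitted increment of the
   first cell is nonnegative. *)
rewrite sumEFin lee_fin.
rewrite -(big_mkord xpredT (fun k => G (grid T N.+1 k.+2) - G (grid T N.+1 k.+1))).
rewrite (telescope_sumr (fun k => G (grid T N.+1 k.+1)))// gridN lerD2l lerN2.
have /andP[+ _] := G_lip (lexx 0) (grid_ge0 T_gt0 N 1) (grid_leT T_gt0 (leq0n N)).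
by rewrite subr_ge0.
Qed.

Let step_cvg t : 0 < t < T -> step N t @[N --> \oo] --> (f t)%:E.
Proof.
move=> /andP[t0 tT]; apply/fine_cvgP; split; first by near=> N; rewrite /step sumEFin.
apply/cvgrPdist_le => e e_gt0.
have [|d d_gt0 dP] := @f_lim t _ e e_gt0; first by rewrite t0.
have cvg0 := @cvg_div_natS R T.
near=> N; rewrite /= /step sumEFin /=.
(* The cell after that of [t] lies strictly to the right of [t] and ends within two cell lengths,
   hence before [t + d]. The next bound keeps [t] out of the last cell, which has no successor. *)
have hd : T / N.+1%:R < d / 2 by near: N; apply: cvgr_lt cvg0 _ _; rewrite divr_gt0.
have hT : T / N.+1%:R < (T - t) / 2.
  by near: N; apply: cvgr_lt cvg0 _ _; rewrite divr_gt0// subr_gt0.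
set h := T / N.+1%:R in hd hT *.
pose k := Num.truncn (t / h).
have /andP[k1 k2] : grid T N.+1 k <= t < grid T N.+1 k.+1.
  have := @truncn_itv R (t / h); rewrite divr_ge0 ?(ltW (cell_gt0 _)) ?(ltW t0)//.
  by move=> /(_ isT); rewrite ler_pdivlMr ?cell_gt0// ltr_pdivrMr ?cell_gt0.
have := gridS T N k; have := gridS T N k.+1; rewrite -/h => e2 e1.
have kN : (k < N)%N.
  rewrite -(ltr_nat R) -(ltr_pM2r (cell_gt0 N)) -/(grid T N.+1 k) -/(grid T N.+1 N).
  have := gridS T N N; rewrite gridN -/h; lra.
rewrite (bigD1 (Ordinal kN))//= big1 ?addr0; last first.
  move=> j /eqP jk; rewrite indicE memNset ?mulr0//= in_itv/= => /andP[j1 j2].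
  apply: jk; apply/val_inj => /=.
  apply/eqP; rewrite eqn_leq.
  have grid_lt i i' : grid T N.+1 i < grid T N.+1 i'.+1 -> (i <= i')%N.
    by rewrite /grid ltr_pM2r ?cell_gt0// ltr_nat ltnS.
  by rewrite !grid_lt ?(le_lt_trans j1 k2) ?(le_lt_trans k1 j2).
rewrite indicE mem_set ?mulr1; last by rewrite /= in_itv/= k1.
rewrite distrC; apply: dP => //; lra.
Unshelve. all: by end_near. Qed.

Lemma integral_density_le :
  (\int[mu]_(t in `]0%R, T[) (f t)%:E <= (G T - G 0)%:E)%E.
Proof.
have -> : (\int[mu]_(t in `]0%R, T[) (f t)%:E)%E =
    (\int[mu]_(t in `]0%R, T[) limn_einf (step^~ t))%E.
  apply: eq_integral => t; rewrite inE/= in_itv/= => tT.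
  by rewrite (cvg_limn_einf_sup (step_cvg tT)).1.
apply: le_trans (fatou _ _ _ _) _ => //.
- move=> N; apply: emeasurable_sum => k; apply/measurable_EFinP.
  exact: measurable_funM.
- by move=> N t _; apply: sume_ge0 => k _; exact: term_ge0.
rewrite limn_einf_lim; apply: lime_le; first exact: is_cvg_einfs.
near=> N; apply: le_trans (integral_step N); apply: ereal_inf_lbound.
by exists N => /=.
Unshelve. all: by end_near. Qed.

End DensityIntegral.

(** * Leftmost maxima of upper semi-continuous paths *)

Section UpperSemicontinuousPaths.
Variable R : realType.
Implicit Types (x : R -> R) (a b c t : R).

Lemma upper_semicontinuous_near x t c : upper_semicontinuous x -> x t < c ->
  \forall s \near t, x s < c.
Proof.
move=> usc xt; have [|V tV VP] := usc t (- c); first by rewrite lte_fin ltrN2.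
by apply: filterS tV => s /VP; rewrite lte_fin ltrN2.
Qed.

Lemma upper_semicontinuous_shift x h : upper_semicontinuous x ->
  upper_semicontinuous (fun t => x (t + h)).
Proof.
move=> usc t c /usc[V tV VP]; exists [set s | V (s + h)]; last by move=> s /VP.
have : (fun s => s + h) @ t --> t + h by apply: cvgD; [exact: cvg_id|exact: cvg_cst].
exact.
Qed.

(** By compactness the upper level sets [x s <= x t] have a cluster point. Were some [x s] larger
    than its value, semi-continuity would give a neighbourhood disjoint from the level set of
    [s]. *)
Lemma upper_semicontinuous_attains_max x a b : upper_semicontinuous x ->
  a <= b -> exists2 t, a <= t <= b & forall s, a <= s <= b -> x s <= x t.
Proof.
move=> usc ab.
pose F : set_system R :=
  [set A | exists2 s, a <= s <= b & [set t | a <= t <= b /\ x s <= x t] `<=` A].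
have FF : ProperFilter F.
  split; first by move=> [s sab /(_ s)]; apply; split.
  split; first by exists a; rewrite ?lexx.
    move=> A A' [s sab sA] [s' s'ab sA'].
    have [ss'|ss'] := leP (x s) (x s'); [exists s'|exists s] => // t [tab le_t].
      by split; [apply: sA|apply: sA']; split => //; exact: le_trans le_t.
    by split; [apply: sA|apply: sA']; split => //; apply: le_trans le_t; exact: ltW.
  by move=> A A' AA' [s sab sA]; exists s => // t /sA/AA'.
have Fab : F `[a, b]%classic.
  by exists a; rewrite ?lexx// => t [tab _]; rewrite /= in_itv.
have [t [tab clt]] := segment_compact FF Fab.
exists t => [|s sab]; first by move: tab; rewrite /= in_itv.
rewrite leNgt; apply/negP => ts.
have Fs : F [set t | a <= t <= b /\ x s <= x t] by exists s.
have [r [[_ sr] rs]] := clt _ _ Fs (upper_semicontinuous_near usc ts).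
by move: rs; rewrite /= ltNge sr.
Qed.

(** Strict before [t] and weak after it: this determines [t], and it passes directly to subintervals
    and shifts. *)
Definition leftmost_max x a b t : Prop :=
  [/\ a <= t <= b, forall s, a <= s -> s < t -> x s < x t
    & forall s, t <= s -> s <= b -> x s <= x t].

(** The infimum of the maximizers is itself a maximizer: otherwise, by semi-continuity, all points
    near it would have values below the maximum. *)
Lemma leftmost_max_ex x a b : upper_semicontinuous x -> a <= b ->
  exists t, leftmost_max x a b t.
Proof.
move=> usc ab; have [m mab mP] := upper_semicontinuous_attains_max usc ab.
pose S := [set t | a <= t <= b /\ x m <= x t].
have S0 : S !=set0 by exists m.
have lbS : has_lbound S by exists a => t [/andP[]].
have aS : a <= inf S by apply: lb_le_inf => // t [/andP[]].
have Sb : inf S <= b.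
  by apply: le_trans (ge_inf lbS (_ : S m)) _ => //; case/andP: mab.
have inS : x m <= x (inf S).
  rewrite leNgt; apply/negP => lt_m.
  have /nbhs_ballP[e /= e_gt0 eP] := upper_semicontinuous_near usc lt_m.
  have [t St te] := inf_adherent e_gt0 (conj S0 lbS).
  have [_] := St; apply/negP; rewrite -ltNge; apply: eP.
  rewrite /ball /= ler0_norm ?opprB; first by rewrite ltrBlDl.
  by rewrite subr_le0 ge_inf.
exists (inf S); split; first by rewrite aS.
  move=> s as_ sS; rewrite ltNge; apply/negP => le_s.
  have : S s by split; [rewrite as_ (le_trans (ltW sS))|exact: le_trans le_s].
  by move=> /(ge_inf lbS); rewrite leNgt sS.
move=> s Ss sb; apply: le_trans inS; apply: mP.
by rewrite sb andbT (le_trans aS).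
Qed.

Lemma leftmost_max_uniq x a b t t' :
  leftmost_max x a b t -> leftmost_max x a b t' -> t = t'.
Proof.
move=> [/andP[at_ tb] lt_ le_] [/andP[at' t'b] lt' le'].
have [tt'|t't|//] := ltgtP t t'.
- have := lt' t at_ tt'; rewrite ltNge => /negP[]; apply: le_ => //; exact: ltW.
- have := lt_ t' at' t't; rewrite ltNge => /negP[]; apply: le' => //; exact: ltW.
Qed.

Lemma leftmost_max_ge x a b t s : leftmost_max x a b t -> a <= s <= b ->
  x s <= x t.
Proof.
move=> [_ lt_t le_t] /andP[as_ sb]; have [ts|st] := leP t s; first exact: le_t.
by apply: ltW; exact: lt_t.
Qed.

Lemma leftmost_max_sub x a b c d t : leftmost_max x a b t -> a <= c -> d <= b ->
  c <= t <= d -> leftmost_max x c d t.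
Proof.
move=> [_ lt_t le_t] ac db ctd; split => // s h1 h2.
  by apply: lt_t => //; exact: le_trans h1.
by apply: le_t => //; exact: le_trans db.
Qed.

Lemma leftmost_max_shift x a b h t :
  leftmost_max x (a + h) (b + h) t ->
  leftmost_max (fun s => x (s + h)) a b (t - h).
Proof.
move=> [/andP[h1 h2] lt_t le_t]; split; first lra.
  by move=> s as_ st; rewrite subrK; apply: lt_t; lra.
by move=> s as_ st; rewrite subrK; apply: le_t; lra.
Qed.

Lemma sup_locationsP x T t : upper_semicontinuous x -> 0 <= T ->
  sup_locations x T t <->
  0 <= t <= T /\ forall s, 0 <= s <= T -> x s <= x t.
Proof.
move=> usc T0; have [m mT mP] := upper_semicontinuous_attains_max usc T0.
have supE : sup (x @` `[0, T]) = x m.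
  apply/eqP; rewrite eq_le; apply/andP; split.
    apply: ge_sup; first by exists (x m), m => //=; rewrite in_itv.
    by move=> _ [s + <-]; rewrite /= in_itv/= => /mP.
  apply: ub_le_sup; last by exists m => //=; rewrite in_itv.
  by exists (x m) => _ [s + <-]; rewrite /= in_itv/= => /mP.
rewrite /sup_locations/= supE in_itv/=.
split=> [[tT ->]//|[tT tP]]; split => //.
by apply/eqP; rewrite eq_le mP//= tP.
Qed.

Lemma leftmost_sup_max x T : upper_semicontinuous x -> 0 <= T ->
  leftmost_max x 0 T (leftmost_sup x T).
Proof.
move=> usc T0; have [t tP] := leftmost_max_ex usc T0.
suff -> : leftmost_sup x T = t by [].
have St : sup_locations x T t.
  apply/sup_locationsP => //; split; first by case: tP.
  by move=> s; exact: leftmost_max_ge tP.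
rewrite /leftmost_sup; apply/eqP; rewrite eq_le; apply/andP; split.
  by apply: ge_inf => //; exists 0 => s [+ _]; rewrite in_itv/= => /andP[].
apply: lb_le_inf; first by exists t.
move=> s /(sup_locationsP _ usc T0)[/andP[s0 sT] sP].
rewrite leNgt; apply/negP; have [tT lt_t _] := tP => /(lt_t _ s0).
by rewrite ltNge sP.
Qed.

Definition reaches x a b c : Prop := exists2 t, t \in `[a, b] & c <= x t.

(* For an upper semi-continuous path: sup_[a,b] x <= sup_[c,d] x. The levels
   are rational so that this is a countable combination of hitting events. *)
Definition sup_le x a b c d : Prop :=
  forall q : rat, reaches x a b (ratr q) -> reaches x c d (ratr q).

Lemma sup_leP x a b c d : upper_semicontinuous x -> c <= d ->
  sup_le x a b c d <->
  forall s, a <= s <= b -> exists2 t, c <= t <= d & x s <= x t.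
Proof.
move=> usc cd; split => [le_x s sab|le_x q [s]].
  have [t tcd tP] := upper_semicontinuous_attains_max usc cd.
  exists t => //; rewrite leNgt; apply/negP => /rat_in_itvoo[q].
  rewrite in_itv/= => /andP[tq qs].
  have [|r] := le_x q; first by exists s; rewrite ?in_itv//= ltW.
  rewrite in_itv/= => /tP rt /(lt_le_trans tq); rewrite ltNge.
  by rewrite rt.
rewrite in_itv/= => /le_x[t tcd st] qs; exists t; rewrite ?in_itv//.
exact: le_trans st.
Qed.

(** The leftmost location expressed through hitting events only. On the whole space of functions,
    where the sigma-algebra lives, it is then measurable without any regularity of [x]. *)
Definition leftmost_argmax x a b : R :=
  inf [set t | a <= t <= b /\ sup_le x a b a t].

Lemma leftmost_argmaxP x a b : upper_semicontinuous x -> a <= b ->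
  leftmost_max x a b (leftmost_argmax x a b).
Proof.
move=> usc ab; have [t tP] := leftmost_max_ex usc ab.
have [/andP[at_ tb] lt_t le_t] := tP.
suff -> : leftmost_argmax x a b = t by [].
have lb : has_lbound [set t | a <= t <= b /\ sup_le x a b a t].
  by exists a => s [/andP[]].
have St : [set t | a <= t <= b /\ sup_le x a b a t] t.
  split; first by rewrite at_.
  apply/sup_leP => // s sab; exists t; rewrite ?at_ ?lexx//.
  exact: leftmost_max_ge sab.
apply/eqP; rewrite eq_le ge_inf//=; apply: lb_le_inf; first by exists t.
move=> s [/andP[as_ sb] /(sup_leP _ _ usc as_)/(_ t)[|r /andP[ar rs] tr]].
  by rewrite at_.
apply: le_trans rs; rewrite leNgt; apply/negP => /(lt_t _ ar).
by rewrite ltNge tr.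
Qed.

(** The condition [sup_le x a b a t] is monotone in [t], so rational [t] suffice below [c] unless
    [b < c]. In that case [b], possibly irrational, is always a witness. *)
Lemma leftmost_argmax_lt x a b c : a <= b ->
  leftmost_argmax x a b < c <->
  b < c \/ exists q : rat, [/\ a <= ratr q <= b, ratr q < c & sup_le x a b a (ratr q)].
Proof.
move=> ab; have lb : has_lbound [set t | a <= t <= b /\ sup_le x a b a t].
  by exists a => s [/andP[]].
have Sb : [set t | a <= t <= b /\ sup_le x a b a t] b.
  by rewrite /= ab lexx; split => // q.
split => [/(inf_lt (ex_intro _ _ Sb))[t [/andP[at_ tb] tP] tc]|[bc|[q [qab qc qP]]]].
- have [bc|cb] := ltP b c; [by left|right].
  have [q] := rat_in_itvoo tc; rewrite in_itv/= => /andP[tq qc].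
  exists q; split => //; first by rewrite (le_trans at_ (ltW tq)) (le_trans (ltW qc)).
  move=> p /tP[s]; rewrite in_itv/= => /andP[as_ st] ps; exists s => //.
  by rewrite in_itv/= as_ (le_trans st (ltW tq)).
- exact: le_lt_trans (ge_inf lb Sb) bc.
- apply: le_lt_trans qc; apply: ge_inf => //; split => //.
Qed.

End UpperSemicontinuousPaths.

Lemma measurable_prop (d : measure_display) (T : measurableType d) (Q : Prop) :
  measurable [set _ : T | Q].
Proof.
have [q|q] := pselect Q.
  by have -> : [set _ : T | Q] = setT by apply/seteqP; split.
by have -> : [set _ : T | Q] = set0 by apply/seteqP; split.
Qed.

(** * Measurability of the leftmost location on path space *)

Section PathMeasurability.
Variable R : realType.
Local Notation path := (g_sigma_algebraType (hitting_sets R)).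

Lemma measurable_reaches (a b c : R) :
  measurable ([set x | reaches x a b c] : set path).
Proof. by apply: sub_sigma_algebra; exists a, b, c. Qed.

Lemma measurable_sup_le (a b c d : R) :
  measurable ([set x | sup_le x a b c d] : set path).
Proof.
have -> : [set x | sup_le x a b c d] = \bigcap_(q : rat)
    (~` [set x | reaches x a b (ratr q)] `|` [set x | reaches x c d (ratr q)]).
  apply/seteqP; split => x /= h q; last by case: (h q I).
  by move=> _; have [/h|] := pselect (reaches x a b (ratr q)); [right|left].
rewrite -[X in measurable X]setCK; apply: measurableC.
rewrite setC_bigcap; apply: bigcupT_measurable_rat => q; apply: measurableC.
by apply: measurableU; [apply: measurableC|]; exact: measurable_reaches.
Qed.

Lemma measurable_leftmost_argmax (a b : R) : a <= b ->
  measurable_fun setT ((fun x => leftmost_argmax x a b) : path -> R).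
Proof.
move=> ab; apply: (measurability _ (RGenInftyO.measurableE R)).
move=> _ [_ [c ->] <-]; rewrite setTI.
have -> : (fun x : path => leftmost_argmax x a b) @^-1` `]-oo, c[%classic =
    [set x | b < c] `|` \bigcup_(q : rat)
    ([set x | a <= ratr q <= b /\ ratr q < c] `&`
     [set x | sup_le x a b a (ratr q)]).
  apply/seteqP; split => x /=; rewrite in_itv/= => H; last first.
    apply/leftmost_argmax_lt => //.
    by case: H => [|[q _ [[h1 h2] h3]]]; [left|right; exists q].
  have [|[q [h1 h2 h3]]] := (leftmost_argmax_lt x c ab).1 H; first by left.
  by right; exists q.
apply: measurableU; first exact: measurable_prop.
by apply: bigcupT_measurable_rat => q; apply: measurableI;
  [exact: measurable_prop|exact: measurable_sup_le].
Qed.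

End PathMeasurability.

(** * The law of the leftmost location *)

Section ArgmaxLaw.
Variables (d : measure_display) (Omega : measurableType d) (R : realType).
Variables (P : probability Omega R) (X : Omega -> R -> R).
Hypothesis usc_X : usc_process X.
Hypothesis stationary_X : stationary P X.
Implicit Types a b c h t T : R.

Let usc w : upper_semicontinuous (X w). Proof. exact: usc_X.1. Qed.

Lemma measurable_path_event (A : set (R -> R)) : <<s hitting_sets R >> A ->
  measurable [set w | A (X w)].
Proof. by move=> mA; rewrite -[X in measurable X]setTI; exact: usc_X.2. Qed.

Lemma measurable_reaches_process a b c : measurable [set w | reaches (X w) a b c].
Proof. exact: measurable_path_event (measurable_reaches a b c). Qed.

Lemma measurable_sup_le_process a b c e : measurable [set w | sup_le (X w) a b c e].
Proof. exact: measurable_path_event (measurable_sup_le a b c e). Qed.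

Definition argmax_process a b (w : Omega) : R := leftmost_argmax (X w) a b.

Lemma argmax_processP a b w : a <= b ->
  leftmost_max (X w) a b (argmax_process a b w).
Proof. exact: leftmost_argmaxP. Qed.

Lemma measurable_argmax_process a b : a <= b ->
  measurable_fun setT (argmax_process a b).
Proof.
move=> ab; exact: measurableT_comp (measurable_leftmost_argmax ab) usc_X.2.
Qed.

Lemma measurable_argmax_event a b (B : set R) : a <= b -> measurable B ->
  measurable (argmax_process a b @^-1` B).
Proof.
by move=> ab mB; rewrite -[X in measurable X]setTI; exact: measurable_argmax_process.
Qed.

Definition prob (A : set Omega) : R := fine (P A).

Lemma probE (A : set Omega) : measurable A -> P A = (prob A)%:E.
Proof. by move=> mA; rewrite fineK// fin_num_measure. Qed.

Lemma prob_ge0 (A : set Omega) : 0 <= prob A.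
Proof. exact: fine_ge0. Qed.

Lemma prob_le (A B : set Omega) : measurable A -> measurable B ->
  A `<=` B -> prob A <= prob B.
Proof.
by move=> mA mB AB; rewrite -lee_fin -!probE//; apply: le_measure; rewrite ?inE.
Qed.

Lemma probU (A B : set Omega) : measurable A -> measurable B ->
  A `&` B = set0 -> prob (A `|` B) = prob A + prob B.
Proof.
move=> mA mB AB; apply: EFin_inj; rewrite EFinD -!probE//; last exact: measurableU.
exact: measureU.
Qed.

Lemma probD (A B : set Omega) : measurable A -> measurable B ->
  prob (A `\` B) = prob A - prob (A `&` B).
Proof.
move=> mA mB; have mAB := measurableI _ _ mA mB.
have mD := measurableD mA mB.
have disj : A `&` B `&` (A `\` B) = set0.
  by apply/seteqP; split => // w [[? ?] []].
by have := congr1 prob (setUIDK A B); rewrite probU// => <-; ring.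
Qed.

Lemma prob_eq0 (A : set Omega) : measurable A ->
  prob A = 0 <-> P.-negligible A.
Proof.
move=> mA; split => [A0|/negligibleP A0].
  by apply/negligibleP => //; have := probE mA; rewrite A0; exact.
by rewrite /prob A0.
Qed.

Definition law a b (B : set R) : R := prob (argmax_process a b @^-1` B).

Lemma law_ge0 a b B : 0 <= law a b B. Proof. exact: prob_ge0. Qed.

Lemma law_set0 a b : law a b set0 = 0.
Proof. by rewrite /law /prob preimage_set0 measure0. Qed.

Lemma law_le a b B B' : a <= b -> measurable B -> measurable B' ->
  (forall t, a <= t <= b -> B t -> B' t) -> law a b B <= law a b B'.
Proof.
move=> ab mB mB' BB'; apply: prob_le; [exact: measurable_argmax_event..|].
by move=> w /=; apply: BB'; have [] := argmax_processP w ab.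
Qed.

Lemma lawU a b B B' : a <= b -> measurable B -> measurable B' ->
  (forall t, B t -> ~ B' t) -> law a b (B `|` B') = law a b B + law a b B'.
Proof.
move=> ab mB mB' BB'; rewrite /law preimage_setU probU//.
- exact: measurable_argmax_event.
- exact: measurable_argmax_event.
- by apply/seteqP; split => // w [/BB'].
Qed.

Lemma law_total a b B : a <= b -> measurable B ->
  (forall t, a <= t <= b -> B t) -> law a b B = 1.
Proof.
move=> ab mB Bab; rewrite /law /prob (_ : _ @^-1` _ = setT) ?probability_setT//.
by apply/seteqP; split => // w _; apply: Bab; have [] := argmax_processP w ab.
Qed.

(** A leftmost maximum over [[a, b]] that falls into [[c, e]] is also the one over [[c, e]], so
    shrinking the window can only increase the mass of [B]. *)
Lemma law_sub a b c e B : a <= c -> c <= e -> e <= b -> measurable B ->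
  (forall t, B t -> c <= t <= e) -> law a b B <= law c e B.
Proof.
move=> ac ce eb mB Bce.
have ab : a <= b by rewrite (le_trans ac)// (le_trans ce).
apply: prob_le; [exact: measurable_argmax_event..|].
move=> w /= Bw.
have lm := leftmost_max_sub (argmax_processP w ab) ac eb (Bce _ Bw).
by rewrite -(leftmost_max_uniq lm (argmax_processP w ce)).
Qed.

Lemma measurable_shift h (B : set R) : measurable B ->
  measurable [set t | B (t + h)].
Proof.
move=> mB; rewrite -[X in measurable X]setTI.
have : measurable_fun setT (fun t : R => t + h) by exact: measurable_funD.
exact.
Qed.

Lemma law_shift a b h B : a <= b -> measurable B ->
  law (a + h) (b + h) B = law a b [set t | B (t + h)].
Proof.
move=> ab mB; rewrite /law /prob.
have mA := measurable_leftmost_argmax ab measurableT (measurable_shift h mB).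
rewrite setTI in mA; have := stationary_X h mA => /= H.
rewrite [in RHS]/argmax_process -[X in _ = fine X]H.
have abh : a + h <= b + h by rewrite lerD2r.
have tauE w : leftmost_argmax (fun s => X w (s + h)) a b =
    argmax_process (a + h) (b + h) w - h.
  apply: leftmost_max_uniq (leftmost_max_shift (argmax_processP w abh)).
  by apply: leftmost_argmaxP => //; exact: upper_semicontinuous_shift.
by congr (fine (P _)); apply/seteqP; split => w /=; rewrite tauE subrK.
Qed.

Lemma law_shift_sub h T T' B : 0 <= h -> 0 <= T' -> h + T' <= T ->
  measurable B -> (forall t, B t -> h <= t <= h + T') ->
  law 0 T B <= law 0 T' [set t | B (t + h)].
Proof.
move=> h0 T'0 hT mB Bh; rewrite -law_shift// add0r [T' + h]addrC.
by apply: law_sub => //; rewrite lerDl.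
Qed.

Definition local_max_event (e : R) : set Omega :=
  [set w | exists2 t, t \in `]0, e[ & local_maximum (X w) t].

(** A local maximum exists in [(0, e)] exactly when, for some rationals [0 < a < c <= c' < b < e],
    the supremum over [[a, b]] is attained in [[c, c']], hence away from the ends of [[a, b]]. *)
Lemma measurable_local_max_event e : measurable (local_max_event e).
Proof.
have -> : local_max_event e = \bigcup_(a : rat) \bigcup_(b : rat)
    \bigcup_(c : rat) \bigcup_(c' : rat)
    ([set w | [/\ 0 < ratr a :> R, ratr a < ratr c :> R,
      ratr c <= ratr c' :> R, ratr c' < ratr b :> R & ratr b < e :> R]] `&`
     [set w | sup_le (X w) (ratr a) (ratr b) (ratr c) (ratr c')]).
  apply/seteqP; split => w.
    move=> [t]; rewrite in_itv/= => /andP[t0 te] /nbhs_ballP[r /= r0 rP].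
    have [|a] := @rat_in_itvoo _ (Num.max 0 (t - r)) t.
      by rewrite gt_max t0; lra.
    rewrite in_itv/= gt_max => /andP[/andP[a0 ar] ta].
    have [|b] := @rat_in_itvoo _ t (Num.min e (t + r)).
      by rewrite lt_min te; lra.
    rewrite in_itv/= lt_min => /andP[tb /andP[be br]].
    have [c] := rat_in_itvoo ta; rewrite in_itv/= => /andP[ac ct].
    have [c'] := rat_in_itvoo tb; rewrite in_itv/= => /andP[tc' c'b].
    exists a => //; exists b => //; exists c => //; exists c' => //; split.
      by split => //; exact: ltW (lt_trans ct tc').
    move=> q [s]; rewrite in_itv/= => /andP[as_ sb] qs; exists t.
      by rewrite in_itv/= !ltW.
    apply: le_trans qs _; apply: rP; rewrite /ball /= ltr_distl; lra.
  move=> [a _ [b _ [c _ [c' _ [[a0 ac cc' c'b be]]]]]].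
  move=> /(sup_leP _ _ (@usc w) cc') le_c.
  have [|m mab mP] := @upper_semicontinuous_attains_max _ _ (ratr a) (ratr b)
    (@usc w); first by rewrite ltW// (lt_le_trans ac)// (le_trans cc')// ltW.
  have [t /andP[ct tc'] mt] := le_c _ mab.
  exists t; first by rewrite in_itv/=; lra.
  near=> s; apply: le_trans mt; apply: mP.
  suff : s \in `]ratr a, ratr b[ by rewrite in_itv/= => /andP[? ?]; rewrite !ltW.
  by near: s; apply: near_in_itvoo; rewrite in_itv/=; lra.
do 4 (apply: bigcupT_measurable_rat => ?).
by apply: measurableI; [exact: measurable_prop|exact: measurable_sup_le_process].
Unshelve. all: by end_near. Qed.

(** Shifting by [h] moves [(h, h + e)] to [(0, e)] and the window to [[-h, T - h]]. A location of
    the supremum in [(0, e)] is interior to that window, thus a local maximum. *)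
Lemma law_le_local_max T h e : 0 <= h -> 0 < e -> h + e <= T ->
  law 0 T `]h, h + e[ <= prob (local_max_event e).
Proof.
move=> h0 e0 hT.
have -> : `]h, h + e[%classic = [set t | `]0, e[%classic (t + - h)].
  by apply/seteqP; split => t /=; rewrite !in_itv/=; lra.
have T0 : 0 <= T by lra.
rewrite -law_shift//; apply: prob_le.
- by apply: measurable_argmax_event => //; rewrite lerD2r.
- exact: measurable_local_max_event.
have hT' : 0 - h <= T - h by rewrite lerD2r.
move=> w /=; rewrite in_itv/= => /andP[t0 te].
have tP := argmax_processP w hT'.
exists (argmax_process (0 - h) (T - h) w); first by rewrite in_itv/= t0.
near=> s; apply: (leftmost_max_ge tP).
suff : s \in `]0 - h, T - h[ by rewrite in_itv/= => /andP[? ?]; rewrite !ltW.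
by near: s; apply: near_in_itvoo; rewrite in_itv/=; lra.
Unshelve. all: by end_near. Qed.

(** Any constant above the limit [K], here [K + 1], bounds the ratio for all small [e]. *)
Lemma assumption_L_bound : assumption_L P X ->
  exists C e0 : R, 0 < e0 /\ forall e, 0 < e -> e < e0 ->
    prob (local_max_event e) <= C * e.
Proof.
move=> [K KP]; exists (K + 1).
have /cvgr_le/(_ (K + 1)) := KP; rewrite ltrDl ltr01 => /(_ isT).
move=> [e0 /= e0_gt0 e0P]; exists e0; split => // e e_gt0 ee0.
have := e0P e; rewrite /= sub0r normrN gtr0_norm// => /(_ ee0 e_gt0).
by rewrite -/(local_max_event e) -/(prob _) mulrC ler_pdivrMr.
Qed.

End ArgmaxLaw.

(** In the sum of [2 y_k - x_k - x_(k+1)] every inner [x] is subtracted twice and the two outer ones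
    once; comparing totals leaves just these two. *)
Lemma variation_of_majorant (R : realDomainType) (x y : nat -> R) N :
  (forall k, (k < N)%N -> x k <= y k) ->
  (forall k, (k < N)%N -> x k.+1 <= y k) ->
  \sum_(0 <= k < N) y k <= \sum_(0 <= k < N.+1) x k ->
  \sum_(0 <= k < N) `|x k.+1 - x k| <= x 0%N + x N.
Proof.
move=> xy xy' sum_le.
apply: le_trans (_ : \sum_(0 <= k < N) (y k + y k - (x k + x k.+1)) <= _).
  rewrite !big_nat; apply: ler_sum => k /andP[_ kN].
  by have := xy k kN; have := xy' k kN; rewrite ler_norml; lra.
have := sum_le; rewrite sumrB !big_split/=.
have := @big_nat_recr _ 0 +%R N 0 x (leq0n N).
have := @big_nat_recl _ 0 +%R N 0 x (leq0n N).
by move=> /= -> e1 e2; lra.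
Qed.

(** Cutting [[s, t]] into equal pieces shorter than [e0] and adding the local bounds preserves the
    constant [C]. *)
Lemma lipschitz_of_local (R : realType) (G : R -> R) (T C e0 : R) : 0 < e0 ->
  (forall s t, 0 <= s -> s <= t -> t <= T -> t - s < e0 ->
     0 <= G t - G s <= C * (t - s)) ->
  forall s t, 0 <= s -> s <= t -> t <= T -> 0 <= G t - G s <= C * (t - s).
Proof.
move=> e0_gt0 G_loc s t s0 st tT.
pose n := Num.truncn ((t - s) / e0).
pose h := (t - s) / n.+1%:R.
have h0 : 0 <= h by rewrite divr_ge0// subr_ge0.
have hn : n.+1%:R * h = t - s by rewrite mulrCA divff ?mulr1// pnatr_eq0.
have he : h < e0.
  by rewrite ltr_pdivrMr// mulrC -ltr_pdivrMr//; exact: truncnS_gt.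
have loc k : (k < n.+1)%N ->
    0 <= G (s + k.+1%:R * h) - G (s + k%:R * h) <= C * h.
  move=> kn; have kh : k.+1%:R * h = k%:R * h + h by rewrite -natr1; ring.
  have -> : C * h = C * ((s + k.+1%:R * h) - (s + k%:R * h)) by rewrite kh; ring.
  apply: G_loc.
  - by rewrite addr_ge0// mulr_ge0.
  - by rewrite kh; lra.
  - have : k.+1%:R * h <= n.+1%:R * h by rewrite ler_wpM2r// ler_nat.
    by rewrite hn; lra.
  - by rewrite kh; lra.
have -> : G t - G s = \sum_(0 <= k < n.+1) (G (s + k.+1%:R * h) - G (s + k%:R * h)).
  rewrite (telescope_sumr (fun k => G (s + k%:R * h)))//.
  by rewrite mul0r addr0 hn [s + _]addrC subrK.
apply/andP; split.
  by rewrite big_nat; apply: sumr_ge0 => k /andP[_ /loc/andP[]].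
rewrite -hn mulrCA mulr_natl -[X in _ *+ X]subn0 -sumr_const_nat.
by rewrite !big_nat; apply: ler_sum => k /andP[_ /loc/andP[]].
Qed.

(** * Dependence of the interior mass on the window *)

Section InteriorMass.
Variables (d : measure_display) (Omega : measurableType d) (R : realType).
Variables (P : probability Omega R) (X : Omega -> R -> R).
Hypothesis usc_X : usc_process X.
Hypothesis stationary_X : stationary P X.
Local Notation mu L := (law P X 0 L).

Lemma law_endpoints_interior (L : R) : 0 < L ->
  mu L [set 0] + mu L `]0, L[ + mu L [set L] = 1.
Proof.
move=> L_gt0; have L0 := ltW L_gt0.
rewrite -lawU//; last by move=> t ->; rewrite /= in_itv/= ltxx.
rewrite -lawU//; last first.
- by move=> t [->|]; rewrite /= ?in_itv/=; lra.
- exact: measurableU.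
apply: law_total => //; first by do 2 (apply: measurableU => //).
move=> t /andP[t0 tL]; have [->|tn0] := eqVneq t 0; first by left; left.
have [->|tnL] := eqVneq t L; first by right.
by left; right; rewrite /= in_itv/= !lt_neqAle tL t0 eq_sym tn0 tnL.
Qed.

(** The complementary masses are compared. Restriction to the first, respectively the last, stretch
    of length [L] shows that the atom at either end can only decrease when the window grows. *)
Lemma law_interior_le (L T : R) : 0 <= L -> L <= T ->
  mu L `]0, L[ <= mu T `]0, T[.
Proof.
(* The degenerate window occurs for a grid with a single cell. *)
move=> L0 LT; have [->|Ln0] := eqVneq L 0.
  by rewrite set_itvoo0 law_set0 law_ge0.
have L_gt0 : 0 < L by rewrite lt_neqAle eq_sym Ln0.
have eL := law_endpoints_interior L_gt0.
have eT := law_endpoints_interior (lt_le_trans L_gt0 LT).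
have h0 : mu T [set 0] <= mu L [set 0].
  by apply: law_sub => // t ->; rewrite lexx.
have hT : mu T [set T] <= mu L [set L].
  have := @law_shift_sub _ _ _ P X usc_X stationary_X (T - L) T L [set T].
  rewrite (_ : [set t | _] = [set L]); last first.
    by apply/seteqP; split => t /= ?; lra.
  apply; [lra|lra|lra|exact: measurable_set1|].
  by move=> t ->; lra.
lra.
Qed.

End InteriorMass.

(** * Lipschitz and grid variation bounds for the law inside the window *)

Section InteriorDistribution.
Variables (d : measure_display) (Omega : measurableType d) (R : realType).
Variables (P : probability Omega R) (X : Omega -> R -> R) (T C e0 : R).
Hypothesis usc_X : usc_process X.
Hypothesis stationary_X : stationary P X.
Hypothesis T_gt0 : 0 < T.
Hypothesis e0_gt0 : 0 < e0.
Hypothesis LM_le : forall e, 0 < e -> e < e0 ->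
  prob P (local_max_event X e) <= C * e.
Local Notation mu L := (law P X 0 L).

Let T_ge0 : 0 <= T. Proof. exact: ltW. Qed.

Lemma law_itv_le (s t : R) : 0 <= s -> s < t -> t <= T -> t - s < e0 ->
  mu T `]s, t[ <= C * (t - s).
Proof.
move=> s0 st tT ts; have d0 : 0 < t - s by rewrite subr_gt0.
apply: le_trans (LM_le d0 ts).
have := @law_le_local_max _ _ _ P X usc_X stationary_X T s (t - s) s0 d0.
by rewrite [s + _]addrC subrK; apply.
Qed.

(** An interval of length [2 e] around [t] has mass at most [2 C e]. *)
Lemma law_atom (t : R) : 0 < t -> t < T -> mu T [set t] = 0.
Proof.
move=> t0 tT; apply/eqP; rewrite eq_le law_ge0 andbT.
apply: (@ler_cvg_to _ 0^'+ _ R (cst (mu T [set t])) (fun e => C * (e + e))).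
- exact: cvg_cst.
- rewrite -[X in _ --> X](mulr0 C) -[X in C * X](addr0 0).
  by apply: cvgMr; apply: cvgD; exact: cvg_at_right_filter.
near=> e.
have e_gt0 : 0 < e by near: e; exact: nbhs_right_gt.
have et : e < t by near: e; exact: nbhs_right_lt.
have eT : e < T - t by near: e; apply: nbhs_right_lt; lra.
have ee0 : e < e0 / 2 by near: e; apply: nbhs_right_lt; rewrite divr_gt0.
rewrite /cst (_ : e + e = (t + e) - (t - e)); last by ring.
apply: le_trans (law_itv_le _ _ _ _); [|lra..].
by apply: law_le => // s _ ->; rewrite /= in_itv/=; lra.
Unshelve. all: by end_near. Qed.

(** The atoms at 0 and [T] are left out, which makes this function Lipschitz on all of [[0, T]];
    inside, it differs from the distribution function by the constant mass at 0. *)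
Definition interior_cdf (t : R) : R := mu T `]0, t[.

Lemma interior_cdfB (s t : R) : 0 <= s -> s <= t -> t <= T ->
  interior_cdf t - interior_cdf s = mu T `]s, t[.
Proof.
rewrite le_eqVlt => /predU1P[<- t0 tT|s0].
  by rewrite /interior_cdf set_itvoo0 law_set0 subr0.
rewrite le_eqVlt => /predU1P[<- sT|st tT].
  by rewrite subrr set_itvoo0 law_set0.
have -> : interior_cdf t = mu T (`]0, s[ `|` [set s] `|` `]s, t[).
  congr law; apply/seteqP; split => r /=; rewrite !in_itv/=.
    by move=> /andP[r0 rt]; have [rs|sr|->] := ltgtP r s; [left; left|right|left; right]; rewrite ?r0//; lra.
  by move=> [[|->]|]; lra.
rewrite lawU//; last first.
- by move=> r [|->]; rewrite /= !in_itv/= ?ltxx//; lra.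
- exact: measurableU.
rewrite lawU//; last by move=> r /=; rewrite in_itv/= => /andP[_ +] rs; rewrite rs ltxx.
by rewrite law_atom//; [rewrite /interior_cdf; ring|exact: lt_le_trans tT].
Qed.

Lemma interior_cdf_lipschitz (s t : R) : 0 <= s -> s <= t -> t <= T ->
  0 <= interior_cdf t - interior_cdf s <= C * (t - s).
Proof.
apply: (lipschitz_of_local e0_gt0) => {}s {}t s0 st tT ts.
rewrite interior_cdfB// law_ge0/=; move: st; rewrite le_eqVlt => /predU1P[<-|st].
  by rewrite set_itvoo0 law_set0 subrr mulr0.
exact: law_itv_le.
Qed.

Lemma interior_cdf_grid N :
  \sum_(0 <= k < N) `|grid_slope interior_cdf T N.+1 k.+1 -
                      grid_slope interior_cdf T N.+1 k|
  <= grid_slope interior_cdf T N.+1 0 + grid_slope interior_cdf T N.+1 N.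
Proof.
have h0 := grid_cell_gt0 T_gt0 N.
pose x k := mu T `]grid T N.+1 k, grid T N.+1 k.+1[.
have xE k : (k < N.+1)%N -> interior_cdf (grid T N.+1 k.+1) -
    interior_cdf (grid T N.+1 k) = x k.
  by move=> kN; apply: interior_cdfB; [exact: grid_ge0|exact: grid_le|exact: grid_leT].
have slopeE k : (k < N.+1)%N -> grid_slope interior_cdf T N.+1 k = x k / (T / N.+1%:R).
  by move=> kN; rewrite /grid_slope /slope xE// gridB.
rewrite !slopeE// -mulrDl big_nat.
rewrite (eq_bigr (fun k => `|x k.+1 - x k| / (T / N.+1%:R))); last first.
  move=> k /andP[_ kN]; rewrite !slopeE//; last exact: ltnW.
  by rewrite -mulrBl normrM (ger0_norm (_ : 0 <= _^-1))// invr_ge0 ltW.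
rewrite -big_nat -mulr_suml ler_pM2r ?invr_gt0//.
(* The window shortened by one cell. Its mass [y k] dominates that of cell [k] by restriction to
   [[0, T']], and that of cell [k.+1] by restriction to [[T - T', T]] and a shift. *)
pose T' := grid T N.+1 N.
have T'E : T' + T / N.+1%:R = T by rewrite /T' -gridS gridN.
have T'0 : 0 <= T' := grid_ge0 T_gt0 N N.
pose y k := mu T' `]grid T N.+1 k, grid T N.+1 k.+1[.
have {h0} h0 := ltW h0.
have T'T : T' <= T by rewrite -[leRHS]T'E lerDl.
apply: (@variation_of_majorant _ x y).
- move=> k kN; apply: law_sub => //.
  move=> t; rewrite /= in_itv/= => /andP[/ltW h1 /ltW h2].
  by rewrite (le_trans (grid_ge0 T_gt0 N k) h1) (le_trans h2 (grid_le T_gt0 N kN)).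
- move=> k kN; rewrite /y.
  have -> : `]grid T N.+1 k, grid T N.+1 k.+1[%classic =
      [set t | `]grid T N.+1 k.+1, grid T N.+1 k.+2[%classic (t + T / N.+1%:R)].
    by apply/seteqP; split => t /=; rewrite !in_itv/= !gridS !ltrD2r.
  apply: law_shift_sub => //; first by rewrite addrC T'E.
  move=> t; rewrite /= in_itv/= => /andP[/ltW h1 /ltW h2].
  have := le_trans h2 (grid_le T_gt0 N (kN : (k.+2 <= N.+1)%N)).
  rewrite (gridS _ _ N) -/T' addrC => ->.
  by rewrite andbT; apply: le_trans h1; rewrite gridS lerDr grid_ge0.
have y_le n : \sum_(0 <= k < n) y k <= mu T' `]0, grid T N.+1 n[.
  elim: n => [|n IH]; first by rewrite big_geq// law_ge0.
  rewrite big_nat_recr//=; apply: le_trans (_ : mu T' (`]0, grid T N.+1 n[ `|`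
    `]grid T N.+1 n, grid T N.+1 n.+1[) <= _).
    rewrite lawU//; first by rewrite lerD2r.
    by move=> t /=; rewrite !in_itv/=; lra.
  apply: law_le => //; first exact: measurableU.
  move=> t _ /=; rewrite !in_itv/=; have := grid_ge0 T_gt0 N n.
  have := grid_le T_gt0 N (leqnSn n); lra.
apply: le_trans (y_le N) _; rewrite -/T'.
apply: le_trans (@law_interior_le _ _ _ P X usc_X stationary_X T' T T'0 T'T) _.
rewrite big_nat (eq_bigr (fun k => interior_cdf (grid T N.+1 k.+1) -
  interior_cdf (grid T N.+1 k))); last by move=> k /andP[_ /xE].
rewrite -big_nat (telescope_sumr (fun k => interior_cdf (grid T N.+1 k)))//.
rewrite gridN [X in _ - X](_ : _ = 0) ?subr0//.
by rewrite /interior_cdf /grid mul0r set_itvoo0 law_set0.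
Qed.

End InteriorDistribution.

(** * Processes whose supremum is a.s. attained in the open interval *)

(** Heine's theorem: if it failed, points having an [e]-distant value at every scale would cluster
    at some [p], against continuity there. *)
Lemma continuous_segment_uniform (R : realType) (x : R -> R) (a b e : R) :
  continuous x -> 0 < e -> exists2 d : R, 0 < d & forall s t : R,
    a <= s <= b -> a <= t <= b -> `|s - t| < d -> `|x s - x t| < e.
Proof.
move=> cx e_gt0; apply: contrapT => no.
pose F : set_system R := [set A | exists2 d, 0 < d & [set s | a <= s <= b /\
  exists2 t, `|s - t| < d & e <= `|x s - x t| ] `<=` A].
have FF : ProperFilter F.
  split.
    move=> [d d_gt0 dA]; apply: no; exists d => // s t sab tab st.
    rewrite ltNge; apply/negP => le_e; apply: (dA s); split => //.
    by exists t.
  split; first by exists 1.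
    move=> A A' [d d_gt0 dA] [d' d'_gt0 dA']; exists (Num.min d d').
      by rewrite lt_min d_gt0.
    move=> s [sab [t]]; rewrite lt_min => /andP[st st'] le_e.
    by split; [apply: dA|apply: dA']; split => //; exists t.
  by move=> A A' AA' [d d_gt0 dA]; exists d => // s /dA/AA'.
have Fab : F `[a, b]%classic.
  by exists 1 => // s [sab _]; rewrite /= in_itv.
have [p [_ clp]] := segment_compact FF Fab.
have [|r /= r_gt0 rP] := (cvgrPdist_lt _ _).1 (cx p) (e / 2).
  by rewrite divr_gt0.
have r2_gt0 : 0 < r / 2 by rewrite divr_gt0.
have Fr : F [set s | a <= s <= b /\
    exists2 t, `|s - t| < r / 2 & e <= `|x s - x t| ] by exists (r / 2).
have [s [[_ [t st le_e]] ps]] := clp _ _ Fr (nbhsx_ballx p (r / 2) r2_gt0).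
have ps' : `|p - s| < r / 2 by exact: ps.
have ps'' : `|p - s| < r by lra.
have pt : `|p - t| < r.
  by rewrite (_ : p - t = (p - s) + (s - t)); [apply: le_lt_trans (ler_normD _ _) _; lra|ring].
have h1 := rP _ ps''; have h2 := rP _ pt.
have : `|x s - x t| < e; last by rewrite ltNge le_e.
rewrite (_ : x s - x t = (x p - x t) - (x p - x s)); last by ring.
apply: le_lt_trans (ler_normB _ _) _; rewrite /= in h1 h2; lra.
Qed.

Section FullInteriorMass.
Variables (d : measure_display) (Omega : measurableType d) (R : realType).
Variables (P : probability Omega R) (X : Omega -> R -> R) (T C e0 : R).
Hypothesis usc_X : usc_process X.
Hypothesis stationary_X : stationary P X.
Hypothesis T_gt0 : 0 < T.
Hypothesis e0_gt0 : 0 < e0.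
Hypothesis LM_le : forall e : R, 0 < e -> e < e0 ->
  prob P (local_max_event X e) <= C * e.
Hypothesis continuous_X : forall w, continuous (X w).
Hypothesis full_mass : law P X 0 T `]0, T[ = 1.
Local Notation mu L := (law P X 0 L).
Local Notation tau := (argmax_process X).

Let T_ge0 : 0 <= T. Proof. exact: ltW. Qed.

Let law_right_end : mu T [set T] = 0.
Proof.
have := law_endpoints_interior P usc_X T_gt0; rewrite full_mass.
have := law_ge0 P X 0 T [set T]; have := law_ge0 P X 0 T [set 0]; lra.
Qed.

(** Full interior mass excludes an atom at [T] for the window [[0, T]], hence by a shift one at
    [T + h] for [[0, T + h]]. The rest lies inside the window, where locations are local maxima. *)
Let law_growth_le (h : R) : 0 < h -> h < e0 -> mu (T + h) `]T, T + h] <= C * h.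
Proof.
move=> h0 he; have T'0 : 0 < T + h by exact: addr_gt0.
have -> : `]T, T + h]%classic = `]T, T + h[ `|` [set T + h].
  apply/seteqP; split => t /=; rewrite !in_itv/=.
    move=> /andP[Tt]; rewrite le_eqVlt => /predU1P[->|tT]; [by right|left].
    by rewrite Tt.
  by move=> [/andP[-> /ltW]//|->]; rewrite lexx ltrDl h0.
rewrite lawU//; last 2 first.
- exact: ltW.
- by move=> t /= + tE; rewrite tE in_itv/= ltxx andbF.
have -> : mu (T + h) [set T + h] = 0.
  suff : mu (T + h) [set T + h] <= mu T [set T].
    by rewrite law_right_end => le0; apply/eqP; rewrite eq_le le0 law_ge0.
  have <- : [set t | [set T + h] (t + h)] = [set T].
    by apply/seteqP; split => t /=; [move/addIr|move=> ->].
  apply: law_shift_sub => //; [exact: ltW|by rewrite addrC|].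
  by move=> t ->; rewrite addrC lexx andbT lerDl.
rewrite addr0 -[X in C * X](addrK T h) [h + T]addrC.
by apply: (law_itv_le usc_X stationary_X LM_le) => //; rewrite ?ltrDl// addrAC subrr add0r.
Qed.

(** The running supremum of the path over [[0, t]]. *)
Let value t w : R := X w (tau 0 t w).

Let value_le s t w : 0 <= s -> s <= t -> value s w <= value t w.
Proof.
move=> s0 st; apply: (leftmost_max_ge (argmax_processP usc_X w (le_trans s0 st))).
have [/andP[-> h] _ _] := argmax_processP usc_X w s0.
by rewrite (le_trans h st).
Qed.

(** The running supremum strictly grows in cell [k] of [[T, T + delta]]: the leftmost maximum up to
    the end of the cell lies in the cell. *)
Let growth (delta : R) N k : set Omega :=
  tau 0 (T + k.+1%:R * (delta / N.+1%:R)) @^-1`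
    `]T + k%:R * (delta / N.+1%:R), T + k.+1%:R * (delta / N.+1%:R)]%classic.

(** The total growth [D] is spread over the cells where growth occurs. By uniform continuity each
    contributes less than [D / M'] for a fine mesh, so at least [M'] of them are needed. *)
Let growth_count (delta : R) w : 0 < delta -> T < tau 0 (T + delta) w ->
  forall M : R, \forall N \near \oo, M <= \sum_(k < N.+1) \1_(growth delta N k) w.
Proof.
move=> delta_gt0 grow M.
have T'_ge0 : 0 <= T + delta by rewrite addr_ge0// ltW.
have T't : T <= T + delta by rewrite lerDl ltW.
pose D := value (T + delta) w - value T w.
have D_gt0 : 0 < D.
  rewrite subr_gt0; have [_ lt_t _] := argmax_processP usc_X w T'_ge0.
  have [/andP[h1 h2] _ _] := argmax_processP usc_X w T_ge0.
  by apply: lt_t => //; exact: le_lt_trans grow.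
(* The maximum with 1 keeps [D / M'] meaningful and positive. *)
pose M' := Num.max M 1.
have M'_gt0 : 0 < M' by rewrite lt_max ltr01 orbT.
have e_gt0 : 0 < D / M' by exact: divr_gt0.
have [h0 h0_gt0 h0P] := continuous_segment_uniform T (T + delta) (@continuous_X w) e_gt0.
have cvg0 := @cvg_div_natS R delta.
near=> N.
have hh0 : delta / N.+1%:R < h0 by near: N; exact: cvgr_lt cvg0 _ _.
apply: (@le_trans _ _ M'); first by rewrite le_max lexx.
rewrite -(ler_pM2l e_gt0) divfK ?gt_eqF//.
set h := delta / N.+1%:R in hh0 *.
have h_gt0 : 0 < h by exact: divr_gt0.
have hN : N.+1%:R * h = delta by rewrite /h mulrCA divff ?mulr1// pnatr_eq0.
pose p k : R := T + k%:R * h.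
have p_ge0 k : 0 <= p k by rewrite addr_ge0// mulr_ge0// ltW.
have Tp k : T <= p k by rewrite lerDl mulr_ge0// ltW.
have pS k : p k.+1 = p k + h by rewrite /p -natr1 mulrDl mul1r addrA.
have pp k : p k <= p k.+1 by rewrite pS lerDl ltW.
have pT k : (k <= N.+1)%N -> p k <= T + delta.
  by move=> kN; rewrite lerD2l -hN ler_pM2r// ler_nat.
have DE : D = \sum_(k < N.+1) (value (p k.+1) w - value (p k) w).
  rewrite -(big_mkord xpredT (fun k => value (p k.+1) w - value (p k) w)).
  rewrite (telescope_sumr (fun k => value (p k) w))//.
  by rewrite /p mul0r addr0 hN.
rewrite [leLHS]DE mulr_sumr; apply: ler_sum => k _; rewrite indicE.
have [/set_mem kB|/negP kB] := boolP (w \in growth delta N k).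
  rewrite mulr1; move: kB; rewrite /growth /= in_itv/= -/h -!/(p _) => /andP[lt_t t_le].
  have pkT := pT _ (ltn_ord k).
  apply: (@le_trans _ _ (value (p k.+1) w - X w (p k))).
    rewrite lerD2l lerN2.
    by apply: (leftmost_max_ge (argmax_processP usc_X w (p_ge0 k))); rewrite p_ge0 lexx.
  apply: ltW.
  apply: le_lt_trans (ler_norm _) _. apply: h0P.
  - by rewrite (le_trans t_le pkT) andbT (le_trans (Tp k))// ltW.
  - by rewrite Tp/= (le_trans (pp k) pkT).
  - rewrite ger0_norm ?subr_ge0 ?(ltW lt_t)//; apply: le_lt_trans hh0.
    by rewrite lerBlDl -pS.
rewrite mulr0 subr_le0.
have [/andP[t_ge0 t_le] _ _] := argmax_processP usc_X w (p_ge0 k.+1).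
apply: (leftmost_max_ge (argmax_processP usc_X w (p_ge0 k))).
rewrite t_ge0 leNgt; apply/negP => lt_t; apply: kB; apply/mem_set.
by rewrite /growth /= in_itv/= -/h -!/(p _) lt_t.
Unshelve. all: by end_near. Qed.

Let measurable_growth (delta : R) N k : 0 < delta -> measurable (growth delta N k).
Proof.
move=> delta_gt0; apply: measurable_argmax_event => //.
by rewrite addr_ge0// mulr_ge0// divr_ge0// ltW.
Qed.

(** Only the last stretch of length [T + h] of the window is kept; shifted back, it becomes
    [[0, T + h]], and the cell becomes [(T, T + h]]. *)
Let prob_growth (delta : R) N k : 0 < delta -> delta / N.+1%:R < e0 ->
  prob P (growth delta N k) <= C * (delta / N.+1%:R).
Proof.
move=> delta_gt0; rewrite /growth; set h := delta / _ => he.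
have h_gt0 : 0 < h by exact: divr_gt0.
have kh0 : 0 <= k%:R * h by rewrite mulr_ge0// ltW.
have kS : T + k.+1%:R * h = (T + h) + k%:R * h by rewrite -natr1; ring.
apply: le_trans (law_growth_le h_gt0 he).
have -> : `]T, T + h]%classic = [set t | `]T + k%:R * h, T + k.+1%:R * h]%classic (t + k%:R * h)].
  by apply/seteqP; split => t /=; rewrite !in_itv/= kS ltrD2r lerD2r.
rewrite -law_shift//; last by rewrite addr_ge0// ltW.
rewrite add0r -kS; apply: law_sub => //.
  by rewrite kS lerDr addr_ge0// ltW.
by move=> t; rewrite /= in_itv/= => /andP[/ltW h1 ->]; rewrite andbT (le_trans _ h1)// lerDr.
Qed.

(* The running maximum is continuous, so if it grew on [T, T + delta] it would
   grow in more and more cells of finer and finer partitions; but the expected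
   number of such cells stays bounded. *)
Lemma law_growth (delta : R) : 0 < delta -> mu (T + delta) `]T, T + delta] = 0.
Proof.
move=> delta_gt0.
have T'_ge0 : 0 <= T + delta by rewrite addr_ge0// ltW.
pose E := tau 0 (T + delta) @^-1` `]T, T + delta]%classic.
have mE : measurable E by exact: measurable_argmax_event.
rewrite /law -/E.
pose S N w : \bar R := (\sum_(k < N.+1) (\1_(growth delta N k) w)%:E)%E.
have mS N k : measurable_fun E (fun w => (\1_(growth delta N k) w)%:E).
  apply/measurable_EFinP; apply: measurable_indic; exact: measurable_growth.
have cvg0 := @cvg_div_natS R delta.
have intS : (\int[P]_(w in E) limn_einf (S^~ w) <= (C * delta)%:E)%E.
  apply: le_trans (fatou _ _ _ _) _ => //.
  - by move=> N; apply: emeasurable_sum => k; exact: mS.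
  - by move=> N w _; apply: sume_ge0 => k _; rewrite lee_fin.
  rewrite limn_einf_lim; apply: lime_le; first exact: is_cvg_einfs.
  near=> N; apply: (@le_trans _ _ (\int[P]_(w in E) S N w)%E).
    by apply: ereal_inf_lbound; exists N => /=.
  have he : delta / N.+1%:R < e0 by near: N; exact: cvgr_lt cvg0 _ _.
  rewrite ge0_integral_sum//.
  apply: (@le_trans _ _ (\sum_(k < N.+1) (C * (delta / N.+1%:R))%:E)%E).
    apply: lee_sum => k _; have mg := measurable_growth N k delta_gt0.
    rewrite integral_indic//.
    apply: le_trans (_ : P (growth delta N k) <= _)%E.
      by apply: le_measure; rewrite ?inE//; exact: measurableI.
    by rewrite (probE P mg) lee_fin prob_growth.
  rewrite sumEFin sumr_const card_ord lee_fin -[X in X <= _]mulr_natr -mulrA divfK ?pnatr_eq0//.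
apply/eqP; apply: contraT => PE0; move: intS; apply: contraLR => _; rewrite -ltNge.
rewrite (eq_integral (cst +oo%E)); last first.
  move=> w; rewrite inE /E /= in_itv/= => /andP[grow _].
  have H : S N w @[N --> \oo] --> +oo%E.
    apply/cvgeyPge => M; have := growth_count delta_gt0 grow M.
    by apply: filterS => N; rewrite /S sumEFin lee_fin.
  by rewrite (cvg_limn_einf_sup H).1.
have PEy : (+oo * P E = +oo)%E.
  rewrite (probE P mE) gt0_mulye//.
  by rewrite lte_fin lt_neqAle eq_sym PE0 prob_ge0.
by rewrite integral_cst// [X in (_ < X)%E]PEy ltry.
Unshelve. all: by end_near. Qed.

End FullInteriorMass.

Lemma negligible_bigcup_rat (d : measure_display) (T : measurableType d)
    (R : realFieldType) (mu : {measure set T -> \bar R}) (F : rat -> set T) :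
  (forall q, mu.-negligible (F q)) -> mu.-negligible (\bigcup_q F q).
Proof.
move=> F0; pose G n := if unpickle n is Some q then F q else set0.
apply: (@negligibleS _ _ _ mu (\bigcup_n G n)).
  move=> t [q _ Fqt]; exists (pickle q); first exact: I.
  rewrite /G pickleK; exact: Fqt.
apply: negligible_bigcup => n; rewrite /G; case: unpickle => [q|]; first exact: F0.
exact: negligible_set0.
Qed.

Section TwoSupLocations.
Variables (d : measure_display) (Omega : measurableType d) (R : realType).
Variables (X : Omega -> R -> R) (T : R).
Hypothesis usc_X : usc_process X.
Hypothesis T_gt0 : 0 < T.

(** Two locations exist exactly when the supremum is attained both in [[0, p]] and in [[q, T]] for
    some rationals [p < q]. Measurability lets the event of Assumption U be discarded as a null
    set. *)
Lemma measurable_two_sup_locations : measurable [set w | exists t1 t2 : R,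
  [/\ t1 != t2, sup_locations (X w) T t1 & sup_locations (X w) T t2]].
Proof.
have T_ge0 := ltW T_gt0.
rewrite (_ : [set w | _] = \bigcup_(p : rat) \bigcup_(q : rat)
  ([set w | [/\ 0 <= ratr p :> R, ratr p < ratr q :> R & ratr q <= T :> R]] `&`
   ([set w | sup_le (X w) 0 T 0 (ratr p)] `&`
    [set w | sup_le (X w) 0 T (ratr q) T]))); last first.
  apply/seteqP; split => w.
    move=> [t1 [t2 [t12]]].
    move=> /(sup_locationsP _ (usc_X.1 w) T_ge0)[t1T t1P].
    move=> /(sup_locationsP _ (usc_X.1 w) T_ge0)[t2T t2P].
    wlog t1t2 : t1 t2 t12 t1T t1P t2T t2P / t1 < t2.
      move=> H; have := t12; rewrite neq_lt => /orP[|t21]; first exact: H.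
      by apply: (H t2 t1) => //; rewrite eq_sym.
    have [p] := rat_in_itvoo t1t2; rewrite in_itv/= => /andP[t1p pt2].
    have [q] := rat_in_itvoo pt2; rewrite in_itv/= => /andP[pq qt2].
    move/andP: t1T => [t1_ge0 t1_le]; move/andP: t2T => [t2_ge0 t2_le].
    have p0 : 0 <= ratr p :> R by rewrite (le_trans t1_ge0)// ltW.
    have qT : ratr q <= T :> R by rewrite (le_trans (ltW qt2)).
    exists p => //; exists q => //; split; first by [].
    split; apply/(sup_leP _ _ (usc_X.1 w)) => // s sT.
      by exists t1; [rewrite t1_ge0 ltW|exact: t1P].
    by exists t2; [rewrite t2_le ltW|exact: t2P].
  move=> [p _ [q _ [[p0 pq qT] []]]].
  move=> /(sup_leP _ _ (usc_X.1 w) p0) le1 /(sup_leP _ _ (usc_X.1 w) qT) le2.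
  have [m mT mP'] := upper_semicontinuous_attains_max (usc_X.1 w) T_ge0.
  have [t1 /andP[t1_ge0 t1p] mt1] := le1 _ mT.
  have [t2 /andP[qt2 t2T] mt2] := le2 _ mT.
  have t12 : t1 < t2 by apply: le_lt_trans t1p _; exact: lt_le_trans qt2.
  exists t1, t2; split; first by rewrite lt_eqF.
    apply/sup_locationsP => //; first exact: usc_X.1.
    split; first by rewrite t1_ge0 (le_trans (ltW t12)).
    by move=> s /mP' sm; exact: le_trans mt1.
  apply/sup_locationsP => //; first exact: usc_X.1.
  split; first by rewrite t2T andbT (le_trans t1_ge0)// ltW.
  by move=> s /mP' sm; exact: le_trans mt2.
do 2 (apply: bigcupT_measurable_rat => ?).
apply: measurableI; first exact: measurable_prop.
by apply: measurableI; exact: measurable_sup_le_process.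
Qed.

End TwoSupLocations.

(** * Shift invariance under full interior mass *)

Section ShiftInvariance.
Variables (d : measure_display) (Omega : measurableType d) (R : realType).
Variables (P : probability Omega R) (X : Omega -> R -> R) (T C e0 : R).
Hypothesis usc_X : usc_process X.
Hypothesis stationary_X : stationary P X.
Hypothesis T_gt0 : 0 < T.
Hypothesis e0_gt0 : 0 < e0.
Hypothesis LM_le : forall e : R, 0 < e -> e < e0 ->
  prob P (local_max_event X e) <= C * e.
Hypothesis continuous_X : forall w, continuous (X w).
Hypothesis full_mass : law P X 0 T `]0, T[ = 1.
Hypothesis U_X : assumption_U P X T.
Variable delta : R.
Hypothesis delta_gt0 : 0 < delta.
Local Notation tau := (argmax_process X).

Let T_ge0 : 0 <= T. Proof. exact: ltW. Qed.
Let Td_ge0 : 0 <= T + delta. Proof. by rewrite addr_ge0// ltW. Qed.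
Let dTd : delta <= T + delta. Proof. by rewrite lerDr. Qed.
Let TTd : T <= T + delta. Proof. by rewrite lerDl ltW. Qed.

Let E := tau 0 (T + delta) @^-1` `]T, T + delta]%classic.

Let mE : measurable E. Proof. exact: measurable_argmax_event. Qed.

Let E0 : P.-negligible E.
Proof.
apply/prob_eq0 => //; exact: (law_growth usc_X stationary_X T_gt0 e0_gt0 LM_le continuous_X full_mass).
Qed.

Let notE w : ~ E w -> tau 0 (T + delta) w = tau 0 T w.
Proof.
move=> nE; have lm := argmax_processP usc_X w Td_ge0.
have [/andP[h1 h2] _ _] := lm.
apply: leftmost_max_uniq (argmax_processP usc_X w T_ge0).
apply: leftmost_max_sub lm _ _ _ => //; rewrite h1 leNgt; apply/negP => lt_t.
by apply: nE; rewrite /E /= in_itv/= lt_t.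
Qed.

(* By stationarity the suprema over [0, T] and [delta, T + delta] have the
   same law; the former dominates the latter, so they are a.s. equal. *)
Let window_sup_ge : P.-negligible (~` [set w | sup_le (X w) 0 T delta (T + delta)]).
Proof.
pose A (q : rat) := [set w | reaches (X w) 0 T (ratr q)].
pose B (q : rat) := [set w | reaches (X w) delta (T + delta) (ratr q)].
have mA q : measurable (A q) by exact: measurable_reaches_process.
have mB q : measurable (B q) by exact: measurable_reaches_process.
apply: (@negligibleS _ _ _ P (\bigcup_q (A q `\` B q))).
  move=> w /= /existsNP[q /not_implyP[Aq nBq]]; by exists q.
apply: negligible_bigcup_rat => q.
have PAB : prob P (A q) = prob P (B q).
  have := stationary_X delta (measurable_reaches 0 T (ratr q)).
  rewrite -/(A q) /prob => <-; congr (fine (P _)); apply/seteqP; split => w /=.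
    move=> [t]; rewrite in_itv/= => /andP[t0 tT] qx; exists (t + delta) => //.
    by rewrite in_itv/= lerD2r tT lerDr t0.
  move=> [t]; rewrite in_itv/= => /andP[t0 tT] qx; exists (t - delta).
    by rewrite in_itv/= subr_ge0 lerBlDr t0.
  by rewrite subrK.
have PBA : prob P (B q `\` A q) = 0.
  apply/prob_eq0; first exact: measurableD.
  apply: negligibleS E0 => w [[t]]; rewrite in_itv/= => /andP[dt tTd] qt nA.
  apply: contrapT => /notE tauE; apply: nA.
  have [tau01 _ _] := argmax_processP usc_X w T_ge0.
  exists (tau 0 T w); first by rewrite in_itv.
  apply: le_trans qt _; rewrite -tauE.
  apply: (leftmost_max_ge (argmax_processP usc_X w Td_ge0)).
  by rewrite tTd andbT (le_trans _ dt)// ltW.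
apply/prob_eq0; first exact: measurableD.
by move: PBA; rewrite !probD// setIC PAB.
Qed.

Lemma law_shift_invariant (B : set R) : measurable B ->
  (forall t, B t -> delta <= t <= T) ->
  law P X 0 T B = law P X 0 T [set t | B (t + delta)].
Proof.
move=> mB BdT; have mB' : measurable [set t | B (t + delta)] by exact: measurable_shift.
rewrite -law_shift// add0r.
have mtau a b : a <= b -> measurable (tau a b @^-1` B).
  by move=> ab; exact: measurable_argmax_event.
(* First inequality: outside the null event [E] the location over [[0, T]] is that over
   [[0, T + delta]], which is then restricted to [[delta, T + delta]]. *)
apply/eqP; rewrite eq_le; apply/andP; split.
  apply: (@le_trans _ _ (law P X 0 (T + delta) B)).
    rewrite -lee_fin -!probE//; last 2 first.
    - exact: mtau.
    - exact: mtau.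
    apply: (@le_trans _ _ (P (tau 0 (T + delta) @^-1` B `|` E))).
      apply: le_measure; rewrite ?inE; [exact: mtau|by apply: measurableU => //; exact: mtau|].
      move=> w Bw; have [Ew|nE] := pselect (E w); [by right|left].
      by rewrite /= notE.
    by rewrite measureU0//; [exact: mtau|exact/negligibleP].
  apply: law_sub => //; first exact: ltW.
  by move=> t /BdT/andP[-> tT]; exact: le_trans TTd.
(* Converse inequality: outside a null set, a location over [[delta, T + delta]] that lies in [B]
   attains the supremum over [[0, T]] too, and by Assumption U it is the only point to do so. *)
have mU := measurable_two_sup_locations usc_X T_gt0.
set U := [set w | _] in mU.
have U0 : P U = 0%E by exact: U_X.
have mN : measurable (~` [set w | sup_le (X w) 0 T delta (T + delta)]).
  by apply: measurableC; exact: measurable_sup_le_process.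
rewrite -lee_fin -!probE//; last 2 first.
- exact: mtau.
- exact: mtau.
apply: (@le_trans _ _ (P (tau 0 T @^-1` B `|`
    (~` [set w | sup_le (X w) 0 T delta (T + delta)] `|` U)))).
  apply: le_measure; rewrite ?inE; [exact: mtau| |].
    by apply: measurableU; [exact: mtau|exact: measurableU].
  move=> w Bw; have [le_w|nle] := pselect (sup_le (X w) 0 T delta (T + delta));
    last by right; left.
  have [Uw|nU] := pselect (U w); first by right; right.
  left; rewrite /= in Bw *.
  have lm := argmax_processP usc_X w T_ge0.
  suff -> : tau 0 T w = tau delta (T + delta) w by [].
  apply/eqP; apply: contraT => neq; exfalso; apply: nU.
  exists (tau 0 T w), (tau delta (T + delta) w); split => //.
    apply/(sup_locationsP _ (usc_X.1 w) T_ge0).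
    by split; [have [] := lm|move=> s; exact: leftmost_max_ge].
  apply/(sup_locationsP _ (usc_X.1 w) T_ge0).
  have /andP[dt tT] := BdT _ Bw; split.
    by rewrite tT andbT (le_trans _ dt)// ltW.
  move=> s sT.
  have [t tdT st] := (sup_leP _ _ (usc_X.1 w) dTd).1 le_w s sT.
  by apply: le_trans st _; apply: leftmost_max_ge (argmax_processP usc_X w dTd) tdT.
rewrite measureU0//; first exact: mtau.
  exact: measurableU.
by rewrite measureU0//; exact/negligibleP.
Qed.

End ShiftInvariance.

(** * The density *)

Section UniformDensity.
Variables (R : realType) (G : R -> R) (T C : R).
Hypothesis T_gt0 : 0 < T.
Hypothesis G_lip : forall s t : R, 0 <= s -> s <= t -> t <= T ->
  0 <= G t - G s <= C * (t - s).
Hypothesis G_total : G T - G 0 = 1.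
Hypothesis G_shift : forall s t delta : R, 0 <= s -> s < t -> 0 < delta ->
  t + delta <= T -> G (t + delta) - G (s + delta) = G t - G s.

(** The [N.+1] cells have equal increments with sum 1, so [G] grows by [N.+1%:R^-1] over any step of
    length [T / N.+1%:R]. Along these steps the slope at [t] is eventually constant. *)
Lemma shift_invariant_slope_limit (t l : R) : 0 <= t -> t < T ->
  right_slope_limit G t l -> l = T^-1.
Proof.
move=> t0 tT /(right_slope_limit_cvg G_lip t0 tT) lP.
have cvg0 := @cvg_div_natS R T.
have step_gt0 := grid_cell_gt0 T_gt0.
have stepN N : N.+1%:R * (T / N.+1%:R) = T by rewrite mulrCA divff ?mulr1// pnatr_eq0.
have shift0 (h s : R) : 0 < h -> 0 <= s -> s + h <= T -> G (s + h) - G s = G h - G 0.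
  move=> h0; rewrite le_eqVlt => /predU1P[<-|s0] sT; first by rewrite add0r.
  have := @G_shift 0 h s (lexx _) h0 s0; rewrite add0r [h + s]addrC; exact.
have cell N : G (T / N.+1%:R) - G 0 = N.+1%:R^-1.
  have h0 := step_gt0 N; have hN := stepN N.
  set h := T / _ in h0 hN *; apply: (@mulfI _ N.+1%:R); first by rewrite pnatr_eq0.
  have tot : G (N.+1%:R * h) - G (0%:R * h) = 1 by rewrite hN mul0r.
  apply: etrans (_ : G (N.+1%:R * h) - G (0%:R * h) = _); last first.
    by rewrite tot divff// pnatr_eq0.
  rewrite -(telescope_sumr (fun k => G (k%:R * h)))//.
  rewrite mulr_natl -[in LHS](subn0 N.+1) -sumr_const_nat !big_nat.
  apply: eq_bigr => k /andP[_ kN]; rewrite -natr1 mulrDl mul1r shift0//.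
    by rewrite mulr_ge0// ltW.
  rewrite -[X in _ + X]mul1r -mulrDl natr1 -[leRHS]hN ler_pM2r// ler_nat //.
have lim_l : slope G t (t + T / N.+1%:R) @[N --> \oo] --> l.
  exact: cvg_comp (cvg_div_natS_right T_gt0) lP.
have lim_c : slope G t (t + T / N.+1%:R) @[N --> \oo] --> T^-1.
  apply: cvg_near_cst; near=> N.
  have hT : T / N.+1%:R < T - t by near: N; apply: cvgr_lt cvg0 _ _; rewrite subr_gt0.
  rewrite /slope shift0//; last by move: hT; rewrite ltrBrDl => /ltW.
  by rewrite cell addrAC subrr add0r invfM invrK mulrCA mulVf ?mulr1// pnatr_eq0.
exact: (cvg_unique _ lim_l lim_c).
Unshelve. all: by end_near. Qed.

End UniformDensity.

Section LeftmostSupDensity.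
Variables (d : measure_display) (Omega : measurableType d) (R : realType).
Variables (P : probability Omega R) (X : Omega -> R -> R) (T C e0 : R).
Hypothesis usc_X : usc_process X.
Hypothesis stationary_X : stationary P X.
Hypothesis T_gt0 : 0 < T.
Hypothesis e0_gt0 : 0 < e0.
Hypothesis LM_le : forall e : R, 0 < e -> e < e0 ->
  prob P (local_max_event X e) <= C * e.
Local Notation mu := (law P X 0 T).
Local Notation G := (interior_cdf P X T).

Let T_ge0 : 0 <= T. Proof. exact: ltW. Qed.

Lemma cdf_leftmost_supE (t : R) : 0 < t -> t < T ->
  cdf_leftmost_sup P X T t = mu [set 0] + G t.
Proof.
move=> t0 tT.
have -> : cdf_leftmost_sup P X T t = mu `]-oo, t].
  rewrite /cdf_leftmost_sup /law /prob; congr (fine (P _)).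
  have supE w : leftmost_sup (X w) T = argmax_process X 0 T w.
    exact: leftmost_max_uniq (leftmost_sup_max (usc_X.1 w) T_ge0)
      (argmax_processP usc_X w T_ge0).
  by apply/seteqP; split => w /=; rewrite in_itv/= supE.
have -> : mu `]-oo, t] = mu ([set 0] `|` `]0, t[ `|` [set t]).
  have m1 : measurable ([set 0] `|` `]0, t[ `|` [set t] : set R).
    by do 2 (apply: measurableU => //).
  apply/eqP; rewrite eq_le; apply/andP; split; apply: law_le => // s /andP[s0 sT].
    rewrite /= !in_itv/= le_eqVlt => /predU1P[->|st]; first by right.
    move: s0; rewrite le_eqVlt => /predU1P[<-|s0]; first by left; left.
    by left; right; rewrite s0.
  by rewrite /= !in_itv/= => -[[->|/andP[_ /ltW]]|->]//; exact: ltW.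
rewrite lawU//; last first.
- by move=> s [->|]; rewrite /= ?in_itv/=; lra.
- exact: measurableU.
rewrite lawU//; last by move=> s ->; rewrite /= in_itv/= ltxx.
by rewrite (law_atom usc_X stationary_X T_gt0 e0_gt0 LM_le t0 tT) addr0.
Qed.

(** The mass at 0 cancels in the difference quotients, so the right derivative is that of
    [interior_cdf]; its existence gives the [lim] in the density its meaning. *)
Lemma density_slope_limit (t : R) : 0 < t < T ->
  right_slope_limit G t (density_leftmost_sup P X T t).
Proof.
move=> /andP[t0 tT].
have lip := interior_cdf_lipschitz usc_X stationary_X T_gt0 e0_gt0 LM_le.
have grd := interior_cdf_grid usc_X stationary_X T_gt0 e0_gt0 LM_le.
have [l lP] := right_slope_limit_ex T_gt0 lip grd (ltW t0) tT.
suff -> : density_leftmost_sup P X T t = l by [].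
apply: cvg_lim => //.
have := right_slope_limit_cvg lip (ltW t0) tT lP.
apply: cvg_trans; apply: near_eq_cvg; near=> h.
have h0 : 0 < h by near: h; exact: nbhs_right_gt.
have hT : h < T - t by near: h; apply: nbhs_right_lt; rewrite subr_gt0.
rewrite !cdf_leftmost_supE//; [|by rewrite addr_gt0|by rewrite -ltrBrDl].
by rewrite /slope; congr (_ / _); ring.
Unshelve. all: by end_near. Qed.

End LeftmostSupDensity.

Theorem theorem3p3 (d : measure_display) (Omega : measurableType d)
    (R : realType) (P : probability Omega R) (X : Omega -> R -> R) (T : R)
    (usc_X : usc_process X) (stationary_X : stationary P X)
    (L_X : assumption_L P X) (T_gt0 : 0 < T) :
  let f := density_leftmost_sup P X T in
  (exists f0 fT : R,
     [/\ f t @[t --> 0^'+] --> f0,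
         f t @[t --> T^'-] --> fT,
         (total_variation_oo 0 T f <= (f0 + fT)%:E)%E
       & (total_variation_oo 0 T f < +oo)%E]) /\
  ((forall w, continuous (X w)) -> assumption_U P X T ->
     (forall t, 0 < t < T -> f t = T^-1) \/
     (\int[lebesgue_measure]_(t in `]0%R, T[) (f t)%:E < 1)%E).
Proof.
move=> f; have [C [e0 [e0_gt0 LM_le]]] := assumption_L_bound L_X.
have lip := interior_cdf_lipschitz usc_X stationary_X T_gt0 e0_gt0 LM_le.
have grd := interior_cdf_grid usc_X stationary_X T_gt0 e0_gt0 LM_le.
have f_lim : forall t, 0 < t < T -> right_slope_limit (interior_cdf P X T) t (f t).
  by move=> t; exact: (density_slope_limit usc_X stationary_X T_gt0 e0_gt0 LM_le).
split.
  have [f0 f0P] := right_slope_limit_ex T_gt0 lip grd (lexx 0) T_gt0.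
  have [fT fTP] := left_slope_limit_ex T_gt0 lip grd T_gt0 (lexx T).
  have TV : (total_variation_oo 0 T f <= (f0 + fT)%:E)%E.
    exact: (total_variation_density_le T_gt0 lip grd f_lim f0P fTP).
  exists f0, fT; split => //.
  - exact: (density_cvg_right T_gt0 lip f_lim f0P).
  - exact: (density_cvg_left T_gt0 lip f_lim fTP).
  - exact: le_lt_trans TV (ltry _).
move=> continuous_X U_X.
have massE : interior_cdf P X T T - interior_cdf P X T 0 = law P X 0 T `]0, T[.
  by rewrite (interior_cdfB usc_X stationary_X T_gt0 e0_gt0 LM_le)// ltW.
(* The mass of the open interval decides: if it is 1, shift invariance makes the density constant;
   otherwise the density integrates to at most this mass, which is below 1. *)
have [full|not_full] := eqVneq (law P X 0 T `]0, T[) 1; [left|right].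
  move=> t /[dup] /f_lim ft /andP[t0 tT].
  apply: (shift_invariant_slope_limit T_gt0 lip _ _ (ltW t0) tT ft).
    by rewrite massE.
  move=> s u delta s0 su delta_gt0 uT.
  have cdfB := interior_cdfB usc_X stationary_X T_gt0 e0_gt0 LM_le.
  rewrite !cdfB//; [|lra..].
  rewrite (law_shift_invariant usc_X stationary_X T_gt0 e0_gt0 LM_le
    continuous_X full U_X delta_gt0)//; last first.
    by move=> r; rewrite /= in_itv/= => /andP[h1 h2]; apply/andP; split; lra.
  by congr law; apply/seteqP; split => r /=; rewrite !in_itv/= !ltrD2r.
apply: le_lt_trans (integral_density_le T_gt0 lip f_lim) _.
rewrite massE lte_fin lt_neqAle not_full/=.
rewrite -(@law_total _ _ _ P X usc_X 0 T setT)//; last exact: ltW.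
by apply: law_le => //; exact: ltW.
Qed.
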